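(* Consider Problem $\Pi$ (defined in the context). If its feasible set is nonempty, then Algorithm 1 (described in full in the context) runs to completion and puts out a feasible vector $x=(x(1),\dots,x(n))$. This output solves Problem $\Pi$, i.e. it minimizes $W$ over the feasible set.
   Context: **Problem $\Pi$.** Let $E=\{1,\dots,n\}$. For each $e\in E$ let $0<b_e\le\infty$, let $w_e:[0,b_e)\to\overline{\mathbb{R}}=\mathbb{R}\cup\{-\infty,+\infty\}$ be a convex function (not necessarily strictly convex or differentiable), let $\beta(e)\in(0,b_e]$ and $\alpha(e)\ge 0$. Problem $\Pi$: minimize $W(x)=\sum_{e=1}^n w_e(x(e))$ over $x=(x(1),\dots,x(n))\in\mathbb{R}^n$ subject to (i) $x(e)\in[0,\beta(e)]$ for $e=1,\dots,n$; (ii) $\sum_{e=1}^{l}x(e)\ge\sum_{e=1}^{l}\alpha(e)$ for $l=1,\dots,n-1$; (iii) $\sum_{e=1}^{n}x(e)=\sum_{e=1}^{n}\alpha(e)$. A vector is feasible if it satisfies (i)-(iii). **Inverse functions.** Let $w_e^+$ and $w_e^-$ be the right and left derivatives of $w_e$. Define $i_e^-(\eta)=\inf\{\zeta: w_e^+(\zeta)\ge\eta\}$ and $i_e^+(\eta)=\sup\{\zeta:w_e^-(\zeta)\le\eta\}$. Their saturated and truncated counterparts are: $H_e^-(\eta)=0$ if $\eta\le w_e^+(0)$; $=i_e^-(\eta)$ if $w_e^+(0)<\eta\le w_e^-(\beta(e))$; $=\beta(e)$ if $\eta>w_e^-(\beta(e))$. $H_e^+(\eta)=0$ if $\eta<w_e^+(0)$;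 $=i_e^+(\eta)$ if $w_e^+(0)\le\eta<w_e^-(\beta(e))$; $=\beta(e)$ if $\eta\ge w_e^-(\beta(e))$. **Algorithm 1.** Let $s(0)=n+1$. For $j=1,2,\dots$ do: 1. For each $l$ with $1\le l<s(j-1)$, let $\eta_l^j$ be the smallest $\eta$ satisfying $\sum_{e=l}^{s(j-1)-1}H_e^-(\eta)\le\sum_{e=l}^{s(j-1)-1}\alpha(e)\le\sum_{e=l}^{s(j-1)-1}H_e^+(\eta)$ if such an $\eta$ exists; otherwise $\eta_l^j$ is undefined. 2. Let $\Gamma_j=\min\{\eta_l^j: 1\le l<s(j-1),\ \eta_l^j \text{ exists}\}$, and let $l_1,\dots,l_r$, ordered so that $s(j-1)>l_1>l_2>\dots>l_r\ge 1$, be the indices attaining this minimum (the tied indices). 3. Set $s(j)$ to the output of Subroutine 1. 4. Set $x(e)$ for $e=s(j),s(j)+1,\dots,s(j-1)-1$ as given by the output of Subroutine 2. 5. If $s(j)=1$, exit; otherwise continue with the next $j$. **Subroutine 1** (input $s(j-1),r,l_1,\dots,l_r,\Gamma_j$; returns $s(j)$). If there is a unique index $l_1$ attaining the minimum ($r=1$), set $s(j)=l_1$. Otherwise initialize $i=1$, $t=r$, $k=l_i$, $m=l_t$, and repeat until $i=t$: if $\sum_{e=m}^{k-1}H_e^+(\Gamma_j)\ge\sum_{e=m}^{k-1}\alpha(e)$ then $i\leftarrow i+1$, $k\leftarrow l_i$; else $t\leftarrow t-1$, $m\leftarrow l_t$. Then set $s(j)=l_i$ and return $s(j)$. **Subroutine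 2** (input $s(j)$, $\Gamma_j$, and $I=\{l_1,\dots,l_p\}$, the set of tied indices at the $j$-th iteration that are strictly larger than $s(j)$, with $s(j-1)>l_1>\dots>l_p>s(j)$; $p=0$ if $I=\emptyset$). 1. Initialize $m=0$, $p_0=p$, $l_0^0=s(j-1)$, $l_{p_0+1}^0=s(j)$, $I_0=I$, $l_i^0=l_i$ for $1\le i\le p_0$. 2. Let $\gamma=\min_{1\le i\le p_m+1}\left\{\sum_{e=l_i^m}^{l_0^m-1}\alpha(e)-\sum_{e=l_i^m}^{l_0^m-1}H_e^-(\Gamma_j)\right\}$ and let $t$ be the largest index $i$ attaining this minimum. 3. Assign $x(e)$ for $e\in\{l_0^m-1,l_0^m-2,\dots,l_1^m\}$ such that $x(e)\in[H_e^-(\Gamma_j),H_e^+(\Gamma_j)]$ and $\sum_{e=l_1^m}^{l_0^m-1}x(e)=\gamma+\sum_{e=l_1^m}^{l_0^m-1}H_e^-(\Gamma_j)$. For $e\in\{l_1^m-1,l_1^m-2,\dots,l_t^m\}$ assign $x(e)=H_e^-(\Gamma_j)$. 4. If $l_t^m=s(j)$, exit. 5. Let $I_{m+1}$ be the set of $l\in I$ with $l<l_t^m$ and $\sum_{e=l}^{l_t^m-1}H_e^+(\Gamma_j)\ge\sum_{e=l}^{l_t^m-1}\alpha(e)$. Put $p_{m+1}=|I_{m+1}|$, $l_0^{m+1}=l_t^m$, $l_{p_{m+1}+1}^{m+1}=s(j)$, and let $l_1^{m+1}>\dots>l_{p_{m+1}}^{m+1}$ be the elements of $I_{m+1}$.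 Set $m\leftarrow m+1$ and go to step 2.
   Formalization: Each w_e is also assumed lower semicontinuous on [0,b_e) (a jump at 0 can leave the minimum unattained) and never -∞ (one-sided derivatives and W would be undefined). η ranges over [-∞,+∞], and w_e takes its limit value at b_e. *)

(* Defs.v *)
From Stdlib Require Export Relation_Operators.
From HB Require Export structures.
From mathcomp Require Export all_boot all_order all_algebra.
From mathcomp Require Export all_classical all_reals all_analysis.
Export Order.TTheory GRing.Theory Num.Theory.
Export numFieldNormedType.Exports.

Set Implicit Arguments.
Unset Strict Implicit.
Unset Printing Implicit Defensive.

Local Open Scope classical_set_scope.
Local Open Scope ring_scope.
Local Open Scope ereal_scope.

Section ConvexFunctions.
Context {R : realType}.
Implicit Types (f w : R -> \bar R) (b : \bar R).

Definition dom b : set R := [set x | 0 <= x%:E < b].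

(* [w] may take the value +oo, with 0 * +oo = 0. *)
Definition convex_on b w : Prop :=
  forall x y t : R, dom b x -> dom b y -> (0 <= t <= 1)%R ->
    w (t * x + (1 - t) * y)%R <= t%:E * w x + (1 - t)%:E * w y.

(* The constraint x(e) \in [0, beta(e)] with beta(e) = b_e finite allows
   x(e) = b_e, where w_e takes its limit value; off [0, b_e] the value is +oo. *)
Definition extend b w (x : R) : \bar R :=
  if 0 <= x%:E < b then w x
  else if x%:E == b then lim (w z @[z --> x^'-])
  else +oo.

(* One-sided derivatives of an extended-real-valued convex function [f] with
   -oo < f.  Where f = +oo no difference quotient makes sense, and the usual
   convention applies: both derivatives are -oo to the left of the effective
   domain {f < +oo} and +oo to the right of it. *)
Definition deriv_off f (z : R) : \bar R :=
  if `[< exists2 y, (z < y)%R & f y < +oo >] then -oo else +oo.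

Definition rderiv f (z : R) : \bar R :=
  if f z == +oo then deriv_off f z
  else lim ((f (z + h)%R - f z) * (h^-1)%:E @[h --> 0%R^'+]).

Definition lderiv f (z : R) : \bar R :=
  if f z == +oo then deriv_off f z
  else lim ((f z - f (z - h)%R) * (h^-1)%:E @[h --> 0%R^'+]).

(* The left derivative at a possibly infinite point. *)
Definition lderiv_ext f (z : \bar R) : \bar R :=
  match z with
  | r%:E => lderiv f r
  | +oo => lim (lderiv f r @[r --> +oo%R])
  | -oo => -oo
  end.

End ConvexFunctions.

(* Vectors of R^n are functions [nat -> R] of which only the values at
   1, ..., n matter; likewise for the families b, beta, w, alpha. *)
Section Problem.
Context {R : realType}.
Variables (n : nat) (b beta : nat -> \bar R) (w : nat -> R -> \bar R).
Variable alpha : nat -> R.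

Definition wx (e : nat) : R -> \bar R := extend (b e) (w e).

Definition W (x : nat -> R) : \bar R := \sum_(1 <= e < n.+1) wx e (x e).

Definition feasible (x : nat -> R) : Prop :=
  [/\ forall e, (1 <= e <= n)%N -> 0 <= (x e)%:E <= beta e,
      forall l, (1 <= l <= n.-1)%N ->
        (\sum_(1 <= e < l.+1) alpha e <= \sum_(1 <= e < l.+1) x e)%R
    & (\sum_(1 <= e < n.+1) x e = \sum_(1 <= e < n.+1) alpha e)%R].

(* zeta ranges over the reals of [0, b_e]; including zeta = b_e (when finite),
   where the right derivative is +oo, makes the infimum b_e when no zeta < b_e
   qualifies.  The left derivative at 0 is -oo (when w_e(0) is finite, because
   the function is +oo to the left of 0), so the set in [ip] contains 0
   whenever w_e is not identically +oo. *)
Definition im (e : nat) (eta : \bar R) : \bar R :=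
  ereal_inf [set z%:E | z in [set z : R | 0 <= z%:E <= b e /\
                                          eta <= rderiv (wx e) z]].

Definition ip (e : nat) (eta : \bar R) : \bar R :=
  ereal_sup [set z%:E | z in [set z : R | 0 <= z%:E <= b e /\
                                          lderiv (wx e) z <= eta]].

Definition Hm (e : nat) (eta : \bar R) : \bar R :=
  if eta <= rderiv (wx e) 0%R then 0
  else if eta <= lderiv_ext (wx e) (beta e) then im e eta
  else beta e.

Definition Hp (e : nat) (eta : \bar R) : \bar R :=
  if eta < rderiv (wx e) 0%R then 0
  else if eta < lderiv_ext (wx e) (beta e) then ip e eta
  else beta e.

(* Sums over the block e = l, ..., s - 1. *)
Definition sumA (l s : nat) : \bar R := (\sum_(l <= e < s) alpha e)%:E.
Definition sumHm (l s : nat) (eta : \bar R) : \bar R :=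
  \sum_(l <= e < s) Hm e eta.
Definition sumHp (l s : nat) (eta : \bar R) : \bar R :=
  \sum_(l <= e < s) Hp e eta.

(* [is_eta s l eta]: eta_l exists and equals eta, where s = s(j-1).  The
   smallest eta is taken in [-oo, +oo]. *)
Definition balanced (s l : nat) (eta : \bar R) : Prop :=
  sumHm l s eta <= sumA l s <= sumHp l s eta.

Definition is_eta (s l : nat) (eta : \bar R) : Prop :=
  balanced s l eta /\ forall eta', balanced s l eta' -> eta <= eta'.

Definition is_Gamma (s : nat) (G : \bar R) : Prop :=
  (exists2 l, (1 <= l < s)%N & is_eta s l G) /\
  forall l eta, (1 <= l < s)%N -> is_eta s l eta -> G <= eta.

(* The tied indices l_1 > ... > l_r. *)
Definition tied (s : nat) (G : \bar R) : seq nat :=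
  [seq l <- rev (iota 1 s.-1) | `[< is_eta s l G >]].

(* The algorithm is nondeterministic (the values x(e) in the second subroutine
   are only constrained), so it is given as a transition relation.
   - [Outer s x]: an iteration is about to start, with s = s(j-1);
   - [Sub1 s G i t x]: loop head of the first subroutine, s = s(j-1);
   - [Sub2 sj G I l0 Im x]: step 2 of the second subroutine, with sj = s(j),
     l0 = l_0^m, Im the decreasing enumeration of I_m;
   - [Exit x]: the algorithm has stopped with output x.
   [x] holds arbitrary values at the indices not yet assigned. *)
Inductive state : Type :=
| Outer (s : nat) (x : nat -> R)
| Sub1 (s : nat) (G : \bar R) (i t : nat) (x : nat -> R)
| Sub2 (sj : nat) (G : \bar R) (I : seq nat) (l0 : nat) (Im : seq nat)
       (x : nat -> R)
| Exit (x : nat -> R).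

(* l_i for 1 <= i <= r *)
Definition tie (s : nat) (G : \bar R) (i : nat) : nat :=
  nth 0%N (s :: tied s G) i.

(* l_i^m for 0 <= i <= p_m + 1 *)
Definition lm (sj l0 : nat) (Im : seq nat) (i : nat) : nat :=
  nth 0%N (l0 :: rcons Im sj) i.

Definition slack (sj : nat) (G : \bar R) (l0 : nat) (Im : seq nat) (i : nat)
    : \bar R :=
  sumA (lm sj l0 Im i) l0 - sumHm (lm sj l0 Im i) l0 G.

Definition is_gamma (sj : nat) (G : \bar R) (l0 : nat) (Im : seq nat)
    (gamma : \bar R) (t : nat) : Prop :=
  [/\ (1 <= t <= (size Im).+1)%N, slack sj G l0 Im t = gamma
    & forall i, (1 <= i <= (size Im).+1)%N ->
        gamma <= slack sj G l0 Im i /\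
        (slack sj G l0 Im i = gamma -> (i <= t)%N)].

(* Steps 2 and 3 of the second subroutine, from x to x'. *)
Definition assigned (sj : nat) (G : \bar R) (l0 : nat) (Im : seq nat)
    (x : nat -> R) (t : nat) (x' : nat -> R) : Prop :=
  let l1 := lm sj l0 Im 1 in
  let lt := lm sj l0 Im t in
  exists gamma : \bar R,
    is_gamma sj G l0 Im gamma t /\
    [/\ forall e, (l1 <= e < l0)%N -> Hm e G <= (x' e)%:E <= Hp e G,
        (\sum_(l1 <= e < l0) x' e)%:E = gamma + sumHm l1 l0 G,
        forall e, (lt <= e < l1)%N -> (x' e)%:E = Hm e G
      & forall e, ~~ (lt <= e < l0)%N -> x' e = x e].

Inductive step : state -> state -> Prop :=
| step_tied s G x :
    is_Gamma s G ->
    step (Outer s x) (Sub1 s G 1 (size (tied s G)) x)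
| step_sub1_i s G i t x :
    i <> t ->
    sumA (tie s G t) (tie s G i) <= sumHp (tie s G t) (tie s G i) G ->
    step (Sub1 s G i t x) (Sub1 s G i.+1 t x)
| step_sub1_t s G i t x :
    i <> t ->
    ~ sumA (tie s G t) (tie s G i) <= sumHp (tie s G t) (tie s G i) G ->
    step (Sub1 s G i t x) (Sub1 s G i t.-1 x)
| step_sub1_return s G i x :
    let sj := tie s G i in
    let I := [seq l <- tied s G | (sj < l)%N] in
    step (Sub1 s G i i x) (Sub2 sj G I s I x)
| step_sub2_loop sj G I l0 Im x t x' :
    assigned sj G l0 Im x t x' ->
    let lt := lm sj l0 Im t in
    lt <> sj ->
    step (Sub2 sj G I l0 Im x)
         (Sub2 sj G I lt
            [seq l <- I | (l < lt)%N && (sumA l lt <= sumHp l lt G)] x')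
| step_sub2_next sj G I l0 Im x t x' :
    assigned sj G l0 Im x t x' ->
    lm sj l0 Im t = sj -> sj <> 1%N ->
    step (Sub2 sj G I l0 Im x) (Outer sj x')
| step_sub2_exit sj G I l0 Im x t x' :
    assigned sj G l0 Im x t x' ->
    lm sj l0 Im t = sj -> sj = 1%N ->
    step (Sub2 sj G I l0 Im x) (Exit x').

Definition reachable : state -> state -> Prop := clos_refl_trans state step.

(* Every run from [c] is finite, and can only stop in a state [Exit x]. *)
Definition runs_to_completion (c : state) : Prop :=
  Acc (fun v u => step u v) c /\
  forall c', reachable c c' ->
    (exists x, c' = Exit x) \/ (exists c'', step c' c'').

Definition start (x0 : nat -> R) : state := Outer n.+1 x0.

End Problem.

(* Main.v *)
(* Given constraint (iii), constraint (ii) says that every tail sum of x is at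
   most the tail sum of alpha.  The vector x is optimal as soon as there are
   multipliers lam(e) in [-oo, +oo], nonincreasing in e, with
   x(e) in [H_e^-(lam(e)), H_e^+(lam(e))] and with a tight tail constraint
   wherever lam drops: the condition on x(e) makes lam(e) a subgradient of w_e,
   and Abel summation gives sum lam(e) (y(e) - x(e)) >= 0 for feasible y.  The
   algorithm builds such a pair from right to left, with lam = Gamma_j on the
   j-th block.  For a fixed Gamma put Phi(l) = sum_{e<l} (H_e^+ - alpha(e)) and
   Psi(l) = sum_{e<l} (alpha(e) - H_e^-).  The index l is tied iff
   Phi(l) <= Phi(s), the first subroutine returns the tied index that minimizes
   Phi (the smallest one in case of equality), and each round of the second
   subroutine moves to the candidate that maximizes Psi.  Minimality of Phi at
   s(j) makes the next Gamma larger than Gamma_j. *)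
Require Import Defs.
From mathcomp Require Import zify ring lra.

Set Implicit Arguments.
Unset Strict Implicit.
Unset Printing Implicit Defensive.

Local Open Scope classical_set_scope.
Local Open Scope ring_scope.
Local Open Scope ereal_scope.

(** * One-sided derivatives of extended-real-valued convex functions *)

(** Two obstacles shape the proof. The first is infinite values: costs, [beta], derivatives and
    levels may all be infinite. Derivatives are therefore handled by order alone, H^+ is truncated
    before the potentials are formed, and on a block with multiplier +oo or -oo, where there is no
    subgradient inequality, every feasible competitor with finite costs is shown to agree with x.
    The second is solvability. A smallest level exists because H^+ is right-continuous and H^- is
    its left limit, so the infimum of the levels at which the sum of H^+ reaches the sum of alpha
    satisfies both inequalities. A round from l0 to lt must spread gamma = Psi(l0) - Psi(lt) over
    [l1, l0). It is nonnegative because no candidate has Psi above Psi(l0), and it fits because lt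
    maximizes Psi and Phi(l1) <= Phi(l0). The tail constraints are then of two kinds: at a candidate
    they say that lt maximizes Psi; at any other index Phi exceeds Phi(l0), so even x = H^+ would
    satisfy them. *)

Section EpiConvex.
Context {R : realType}.
Implicit Types (f : R -> \bar R) (u x y z v a c k t : R) (m eta : \bar R).

(* Convexity of the epigraph; unlike [convex_on] it involves no product with
   an infinite value. *)
Definition epi_convex f := forall x y z a c, (x < y < z)%R ->
  f x <= a%:E -> f z <= c%:E ->
  f y <= ((a * (z - y) + c * (y - x)) / (z - x))%:E.

Lemma fin_or_pinfty f : (forall x, -oo < f x) ->
  forall x, f x = +oo \/ exists v, f x = v%:E.
Proof. by move=> fNy x; have := fNy x; case: (f x) => [v| |] //; [right; exists v|left]. Qed.

Variable f : R -> \bar R.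
Hypothesis f_cvx : epi_convex f.
Hypothesis f_gtNy : forall x, -oo < f x.

(** Convexity makes the difference quotient monotone in [h], so its limit at 0 is an infimum over
    all [h > 0], and bounds on derivatives become inequalities between chords. *)
Lemma rderivE z v : f z = v%:E ->
  rderiv f z = ereal_inf
    [set (f (z + h)%R - f z) * (h^-1)%:E | h in `]0%R, +oo[].
Proof.
move=> fz; rewrite /rderiv fz /=.
apply/cvg_lim => //; apply: (nondecreasing_at_right_cvge +oo%O) => //.
move=> h k; rewrite !in_itv/= !andbT => h0 k0 hk.
have [->//|hnk] := eqVneq h k.
have {hnk}hk : (h < k)%R by rewrite lt_neqAle hnk.
have [->|[c fk]] := fin_or_pinfty f_gtNy (z + k)%R.
  by rewrite addye// gt0_mulye ?lte_fin ?invr_gt0// leey.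
have zhk : (z < z + h < z + k)%R by lra.
have := @f_cvx z (z + h)%R (z + k)%R v c zhk; rewrite fz fk !lexx => /(_ isT isT) H.
have [fh|[d fh]] := fin_or_pinfty f_gtNy (z + h)%R; first by rewrite fh in H.
rewrite fh -!EFinB -!EFinM lee_fin.
move: H; rewrite fh lee_fin.
have -> : (z + k - z = k)%R by ring.
rewrite ler_pdivlMr// => H.
rewrite ler_pdivrMr// mulrAC ler_pdivlMr//; nra.
Qed.

Lemma rderiv_le z y v c : f z = v%:E -> (z < y)%R -> f y <= c%:E ->
  rderiv f z <= ((c - v) / (y - z))%:E.
Proof.
move=> fz zy fy; rewrite (rderivE fz); apply: (@le_trans _ _ ((f y - f z) * ((y - z)^-1)%:E)).
  apply: ereal_inf_lbound; exists (y - z)%R; first by rewrite /= in_itv/= subr_gt0 zy.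
  by have -> : (z + (y - z) = y)%R by ring.
rewrite EFinM lee_wpmul2r//; first by rewrite lee_fin invr_ge0 subr_ge0 ltW.
by rewrite fz EFinB leeB.
Qed.

Lemma le_rderiv z v m : f z = v%:E ->
  (forall y c, (z < y)%R -> f y = c%:E -> m <= ((c - v) / (y - z))%:E) ->
  m <= rderiv f z.
Proof.
move=> fz H; rewrite (rderivE fz); apply/ereal_infP => _ [h + <-].
rewrite /= in_itv/= andbT => h0; rewrite fz.
have [->|[c fh]] := fin_or_pinfty f_gtNy (z + h)%R.
  by rewrite addye// gt0_mulye ?lte_fin ?invr_gt0// leey.
have := H (z + h)%R c; rewrite fh -EFinB -EFinM.
have -> : (z + h - z = h)%R by ring.
by apply=> //; rewrite ltrDl.
Qed.

Lemma lderivE z v : f z = v%:E ->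
  lderiv f z = ereal_sup
    [set (f z - f (z - h)%R) * (h^-1)%:E | h in `]0%R, +oo[].
Proof.
move=> fz; rewrite /lderiv fz /=.
apply/cvg_lim => //; apply: (nonincreasing_at_right_cvge +oo%O) => //.
move=> h k; rewrite !in_itv/= !andbT => h0 k0 hk.
have [->//|hnk] := eqVneq h k.
have {hnk}hk : (h < k)%R by rewrite lt_neqAle hnk.
have [->|[c fk]] := fin_or_pinfty f_gtNy (z - k)%R.
  by rewrite addeNy// gt0_mulNye ?lte_fin ?invr_gt0// leNye.
have zhk : (z - k < z - h < z)%R by lra.
have := @f_cvx (z - k)%R (z - h)%R z c v zhk; rewrite fz fk !lexx => /(_ isT isT) H.
have [fh|[d fh]] := fin_or_pinfty f_gtNy (z - h)%R; first by rewrite fh in H.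
rewrite fh -!EFinB -!EFinM lee_fin.
move: H; rewrite fh lee_fin.
have -> : (z - (z - k) = k)%R by ring.
rewrite ler_pdivlMr// => H.
rewrite ler_pdivrMr// mulrAC ler_pdivlMr//; nra.
Qed.

Lemma le_lderiv z y v c : f z = v%:E -> (y < z)%R -> f y <= c%:E ->
  ((v - c) / (z - y))%:E <= lderiv f z.
Proof.
move=> fz yz fy; rewrite (lderivE fz).
apply: (@le_trans _ _ ((f z - f y) * ((z - y)^-1)%:E)); last first.
  apply: ereal_sup_ubound; exists (z - y)%R; first by rewrite /= in_itv/= subr_gt0 yz.
  by have -> : (z - (z - y) = y)%R by ring.
rewrite EFinM lee_wpmul2r//; first by rewrite lee_fin invr_ge0 subr_ge0 ltW.
by rewrite fz EFinB leeB.
Qed.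

Lemma lderiv_le z v m : f z = v%:E ->
  (forall y c, (y < z)%R -> f y = c%:E -> ((v - c) / (z - y))%:E <= m) ->
  lderiv f z <= m.
Proof.
move=> fz H; rewrite (lderivE fz); apply/ereal_supP => _ [h + <-].
rewrite /= in_itv/= andbT => h0; rewrite fz.
have [->|[c fh]] := fin_or_pinfty f_gtNy (z - h)%R.
  by rewrite addeNy// gt0_mulNye ?lte_fin ?invr_gt0// leNye.
have := H (z - h)%R c; rewrite fh -EFinB -EFinM.
have -> : (z - (z - h) = h)%R by ring.
by apply=> //; rewrite gtrBl.
Qed.

Lemma lderiv_le_rderiv z : lderiv f z <= rderiv f z.
Proof.
have [fz|[v fz]] := fin_or_pinfty f_gtNy z.
  by rewrite /lderiv /rderiv fz eqxx.
apply: (le_rderiv fz) => y c zy fy; apply: (lderiv_le fz) => x a xz fx.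
have := @f_cvx x z y a c; rewrite xz zy fx fy fz !lexx lee_fin => /(_ isT isT isT).
rewrite lee_fin ler_pdivlMr ?ler_pdivrMr ?subr_gt0//; last lra.
by rewrite mulrAC ler_pdivlMr ?subr_gt0//; nra.
Qed.

(** At finite values both sides are separated by the slope of the chord. At infinite values the
    convention of [deriv_off] works because the effective domain is an interval: it gives -oo to the
    left and +oo to the right. *)
Lemma rderiv_le_lderiv z z' : (z < z')%R -> rderiv f z <= lderiv f z'.
Proof.
move=> zz'; have [fz|[v fz]] := fin_or_pinfty f_gtNy z.
  rewrite /rderiv fz eqxx /deriv_off; case: asboolP => [_|nfin]; first exact: leNye.
  rewrite /lderiv ifT; last first.
    by have [->//|[v' fz']] := fin_or_pinfty f_gtNy z'; case: nfin; exists z'; rewrite ?fz' ?ltry.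
  rewrite /deriv_off; case: asboolP => // -[y z'y fy]; case: nfin.
  by exists y => //; exact: lt_trans z'y.
have [fz'|[v' fz']] := fin_or_pinfty f_gtNy z'.
  rewrite /lderiv fz' eqxx /deriv_off; case: asboolP => [[y z'y fy]|_]; last exact: leey.
  have [fy'|[c fy']] := fin_or_pinfty f_gtNy y; first by rewrite fy' in fy.
  by have := @f_cvx z z' y v c; rewrite zz' z'y fz fz' fy' => /(_ isT (lexx _) (lexx _)).
apply: (@le_trans _ _ ((v' - v) / (z' - z))%:E).
  by apply: (rderiv_le fz zz'); rewrite fz'.
by apply: (le_lderiv fz' zz'); rewrite fz.
Qed.


Lemma rderiv_lty z y : (z < y)%R -> f y < +oo -> rderiv f z < +oo.
Proof.
move=> zy fy; have [fz|[v fz]] := fin_or_pinfty f_gtNy z.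
  by rewrite /rderiv fz eqxx /deriv_off asboolT//; exists y.
have [fy'|[c fy']] := fin_or_pinfty f_gtNy y; first by rewrite fy' in fy.
by apply: le_lt_trans (ltry _); apply: (rderiv_le fz zy); rewrite fy'.
Qed.

Lemma lderiv_gtNy z y : (y < z)%R -> f y < +oo -> -oo < lderiv f z.
Proof.
move=> yz fy; have [fy'|[c fy']] := fin_or_pinfty f_gtNy y; first by rewrite fy' in fy.
have [fz|[v fz]] := fin_or_pinfty f_gtNy z.
  rewrite /lderiv fz eqxx /deriv_off; case: asboolP => // -[u zu fu].
  have [fu'|[d fu']] := fin_or_pinfty f_gtNy u; first by rewrite fu' in fu.
  by have := @f_cvx y z u c d; rewrite yz zu fz fy' fu' => /(_ isT (lexx _) (lexx _)).
by apply: lt_le_trans (ltNyr _) _; apply: (le_lderiv fz yz); rewrite fy'.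
Qed.

Definition lsc_at f x := forall a, a%:E < f x ->
  exists2 V, nbhs x V & forall u, V u -> a%:E < f u.

Lemma lsc_segment x y k c : lsc_at f x ->
  (forall t, (0 < t < 1)%R ->
     f (x + t * (y - x))%R <= (c - k * ((1 - t) * (y - x)))%:E) ->
  f x <= (c - k * (y - x))%:E.
Proof.
move=> lsc H; rewrite leNgt; apply/negP; set D := (y - x)%R in H *.
move=> cfx; have [a /andP[ca afx]] : exists a, (c - k * D < a)%R && (a%:E < f x).
  have [fx|[v fx]] := fin_or_pinfty f_gtNy x.
    by exists (c - k * D + 1)%R; rewrite fx ltry andbT ltrDl.
  exists ((c - k * D + v) / 2)%R; move: cfx; rewrite fx !lte_fin; lra.
have [V [/= e e0 xeV] Vf] := lsc _ afx.
(* [t] is so small that [x + t * D] stays in the ball where [f > a], and that the affine bound at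
   [t], which differs from [c - k * D] by [t * k * D], is below [a]. The summands 1 keep the
   denominators positive. *)
pose t := Num.min 2^-1%R (Num.min (e / (`|D| + 1)) ((a - (c - k * D)) / (`|k * D| + 1)))%R.
have t0 : (0 < t)%R.
  by rewrite !lt_min !divr_gt0 ?subr_gt0//= ?invr_gt0 ?ltr0n// ltr_pwDr.
have tD : (t * (`|D| + 1) <= e)%R.
  by rewrite -ler_pdivlMr ?ltr_pwDr// !ge_min lexx !orbT.
have tkD : (t * (`|k * D| + 1) <= a - (c - k * D))%R.
  by rewrite -ler_pdivlMr ?ltr_pwDr// !ge_min lexx !orbT.
have t1 : (t <= 2^-1)%R by rewrite !ge_min lexx.
have /Vf : V (x + t * D)%R.
  by apply: xeV; rewrite /ball/= opprD addNKr normrN normrM (gtr0_norm t0); nra.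
have t01 : (0 < t < 1)%R by lra.
move=> /lt_le_trans/(_ (H _ t01)); rewrite lte_fin.
have := ler_norm (k * D); nra.
Qed.

(** Each interior [z] lies below the line of slope [k] through the graph point at [y]; lower
    semicontinuity carries this to [x]. Only derivatives strictly between [x] and [y] enter, since a
    bound on H^- constrains the derivatives to the right of [x] and not at [x] itself. *)
Lemma rderiv_ge_subgradient x y k : (x < y)%R -> lsc_at f x ->
  (forall z, (x < z < y)%R -> k%:E <= rderiv f z) ->
  f x + (k * (y - x))%:E <= f y.
Proof.
move=> xy lsc xk; have [->|[c fy]] := fin_or_pinfty f_gtNy y; first exact: leey.
rewrite fy -leeBrDr// -EFinB; apply: (lsc_segment lsc) => t t01.
set z := (x + _)%R; have xzy : (x < z < y)%R by rewrite /z; nra.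
have -> : ((1 - t) * (y - x) = y - z)%R by rewrite /z; ring.
have := xk _ xzy; case/andP: xzy => xz zy.
have [fz|[v fz]] := fin_or_pinfty f_gtNy z.
  by rewrite /rderiv fz eqxx /deriv_off asboolT//; exists y; rewrite ?fy ?ltry.
have := @rderiv_le _ _ _ c fz zy; rewrite fy lexx => /(_ isT) fzc /le_trans/(_ fzc).
rewrite fz !lee_fin ler_pdivlMr ?subr_gt0//; lra.
Qed.

Lemma lderiv_le_subgradient x y k : (y < x)%R -> lsc_at f x ->
  (forall z, (y < z < x)%R -> lderiv f z <= k%:E) ->
  f x + (k * (y - x))%:E <= f y.
Proof.
move=> yx lsc xk; have [->|[c fy]] := fin_or_pinfty f_gtNy y; first exact: leey.
rewrite fy -leeBrDr// -EFinB; apply: (lsc_segment lsc) => t t01.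
set z := (x + _)%R; have yzx : (y < z < x)%R by rewrite /z; nra.
have -> : ((1 - t) * (y - x) = y - z)%R by rewrite /z; ring.
have := xk _ yzx; case/andP: yzx => yz zx.
have [fz|[v fz]] := fin_or_pinfty f_gtNy z.
  rewrite /lderiv fz eqxx /deriv_off; case: asboolP => // -[u zu fu] _.
  have [fu'|[d fu']] := fin_or_pinfty f_gtNy u; first by rewrite fu' in fu.
  by have := @f_cvx y z u c d; rewrite yz zu fz fy fu' => /(_ isT (lexx _) (lexx _)).
have := @le_lderiv _ _ _ c fz yz; rewrite fy lexx => /(_ isT) fzc /(le_trans fzc).
rewrite fz !lee_fin ler_pdivrMr ?subr_gt0//; lra.
Qed.

End EpiConvex.

(** * Extension to the right endpoint *)

Section LeftLimit.
Context {R : realType}.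
Implicit Types (g : R -> \bar R) (L m : \bar R) (r u : R).

Lemma cvg_at_left_interval g r L (P : set (\bar R)) :
  g z @[z --> r^'-] --> L -> open P -> P L ->
  exists2 u, (u < r)%R & forall z, (u < z < r)%R -> P (g z).
Proof.
move=> gL oP PL; have [e /= e0 He] : \forall z \near r^'-, P (g z).
  by apply: gL; exact: open_nbhs_nbhs.
exists (r - e)%R; first by rewrite gtrBl.
move=> z /andP[rez zr]; apply: He => //=.
by rewrite gtr0_norm ?subr_gt0//; lra.
Qed.

Lemma nondecreasing_at_left_is_cvge g u r : (u < r)%R ->
  {in `]u, r[%R &, {homo g : x y / (x <= y)%R >-> x <= y}} -> cvg (g z @[z --> r^'-]).
Proof.
move=> ur gnd; apply: cvgP; apply/cvg_at_leftNP.
apply: (nonincreasing_at_right_cvge (BLeft (- u)%R)).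
  by rewrite bnd_simp ltrN2.
move=> x y; rewrite !in_itv/= => xi yi xy; apply: gnd; rewrite ?in_itv/= ?lerN2//; lra.
Qed.

Lemma nonincreasing_at_left_is_cvge g u r : (u < r)%R ->
  {in `]u, r[%R &, {homo g : x y / (x <= y)%R >-> y <= x}} -> cvg (g z @[z --> r^'-]).
Proof.
move=> ur gni; apply: cvgP; apply/cvg_at_leftNP.
apply: (nondecreasing_at_right_cvge (BLeft (- u)%R)).
  by rewrite bnd_simp ltrN2.
move=> x y; rewrite !in_itv/= => xi yi xy; apply: gni; rewrite ?in_itv/= ?lerN2//; lra.
Qed.

End LeftLimit.

Section Extension.
Context {R : realType}.
Implicit Types (x y z r u a c : R) (L : \bar R).
Variables (b : \bar R) (w : R -> \bar R).
Hypothesis b_gt0 : 0 < b.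
Hypothesis w_cvx : convex_on b w.
Hypothesis w_gtNy : forall x, dom b x -> -oo < w x.
Hypothesis w_lsc : @lower_semicontinuous (subspace (dom b)) R w.

Lemma dom_fin_or_pinfty x : dom b x -> w x = +oo \/ exists v, w x = v%:E.
Proof. by move=> /w_gtNy; case: (w x) => [v| |] //; [right; exists v|left]. Qed.

Lemma convex_on_interpolation x y z (a c : R) : dom b x -> dom b z ->
  (x < y < z)%R -> w x <= a%:E -> w z <= c%:E ->
  w y <= ((a * (z - y) + c * (y - x)) / (z - x))%:E.
Proof.
move=> bx bz /andP[xy yz] wxa wzc.
have xz : (0 < z - x)%R by lra.
pose t := ((z - y) / (z - x))%R.
have t01 : (0 <= t <= 1)%R.
  by rewrite /t divr_ge0 ?ler_pdivrMr//=; lra.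
have ytxz : y = (t * x + (1 - t) * z)%R by rewrite /t; field; lra.
have -> : ((a * (z - y) + c * (y - x)) / (z - x))%:E = t%:E * a%:E + (1 - t)%:E * c%:E.
  by rewrite -!EFinM -EFinD /t; congr EFin; field; lra.
rewrite ytxz; apply: le_trans (w_cvx bx bz t01) _.
by apply: leeD; apply: lee_wpmul2l => //; rewrite lee_fin; lra.
Qed.

Lemma le_left_limit r u (c : R) L : w z @[z --> r^'-] --> L -> (u < r)%R ->
  L < c%:E -> exists2 z, (u < z < r)%R & w z < c%:E.
Proof.
move=> wL ur Lc; have [v vr wc] := @cvg_at_left_interval _ _ _ _ [set y | y < c%:E] wL (@open_ereal_lt_ereal _ _) Lc.
pose z := ((Num.max u v + r) / 2)%R.
have uvr : (Num.max u v < r)%R by rewrite gt_max ur.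
have := le_max u u v; have := le_max v u v; rewrite !lexx ?orbT /= => vm um.
by exists z; [|apply: wc]; rewrite /z; lra.
Qed.

(** A convex function is eventually monotone: once it has strictly increased from [x] to [u] it is
    nondecreasing after [u], and if it never strictly increases it is nonincreasing throughout. *)
Lemma cvg_left_endpoint r : b = r%:E -> cvg (w z @[z --> r^'-]).
Proof.
move=> br; have r0 : (0 < r)%R by rewrite -lte_fin -br.
have domP x : (0 <= x < r)%R -> dom b x by rewrite /dom /= br lee_fin lte_fin.
have [[x [u [/andP[x0 xu] ur wxu]]]|ni] :=
    pselect (exists x u, [/\ (0 <= x < u)%R, (u < r)%R & w x < w u]).
  apply: (@nondecreasing_at_left_is_cvge _ _ u) => // y z.
  rewrite !in_itv/= => /andP[uy yr] /andP[uz zr] yz.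
  have [->//|yz'] := eqVneq y z; have {}yz : (y < z)%R by rewrite lt_neqAle yz'.
  have [->|[c wz]] := @dom_fin_or_pinfty z ltac:(apply: domP; lra); first exact: leey.
  have [wx|[a wx]] := @dom_fin_or_pinfty x ltac:(apply: domP; lra).
    by move: wxu; rewrite wx ltNge leey.
  have := @convex_on_interpolation x y z a c.
  have := @convex_on_interpolation x u z a c.
  rewrite wx wz => /(_ ltac:(apply: domP; lra) ltac:(apply: domP; lra)) H1.
  move=> /(_ ltac:(apply: domP; lra) ltac:(apply: domP; lra)) H2.
  have := H1 ltac:(lra) (lexx _) (lexx _); have := H2 ltac:(lra) (lexx _) (lexx _).
  move=> {H1 H2} wy wu; apply: le_trans wy _; rewrite lee_fin ler_pdivrMr; last lra.
  have : (a < c)%R.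
    have := lt_le_trans wxu wu; rewrite wx lte_fin ltr_pdivlMr; last lra.
    by nra.
  by nra.
apply: (@nonincreasing_at_left_is_cvge _ _ 0%R) => // y z.
rewrite !in_itv/= => /andP[y0 yr] /andP[z0 zr] yz.
have [->//|yz'] := eqVneq y z; have {}yz : (y < z)%R by rewrite lt_neqAle yz'.
by rewrite leNgt; apply/negP => wyz; apply: ni; exists y, z; rewrite (ltW y0) yz.
Qed.

Lemma left_limit_interpolation r x y (a c : R) L : b = r%:E ->
  w z @[z --> r^'-] --> L -> (0 <= x < y)%R -> (y < r)%R ->
  w x <= a%:E -> L <= c%:E ->
  w y <= ((a * (r - y) + c * (y - x)) / (r - x))%:E.
Proof.
move=> br wL /andP[x0 xy] yr wxa Lc.
have domP u : (0 <= u < r)%R -> dom b u by rewrite /dom /= br lee_fin lte_fin.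
have [wy|[v wy]] := @dom_fin_or_pinfty y ltac:(apply: domP; lra).
  have Lc1 : L < (c + 1)%:E by apply: le_lt_trans Lc _; rewrite lte_fin ltrDl.
  have [z /andP[yz zr] wz] := le_left_limit wL yr Lc1.
  have := @convex_on_interpolation x y z a (c + 1)%R ltac:(apply: domP; lra)
    ltac:(apply: domP; lra) ltac:(lra) wxa (ltW wz).
  by rewrite wy.
rewrite wy lee_fin ler_pdivlMr; last lra.
rewrite -lerBlDl; apply/ler_addgt0Pr => d d0.
(* The endpoint is replaced by a point [z] close to [r]. Using [w z] for the limit costs
   [e * (y - x)], using [z] for [r] costs [(v - a) * (r - z)]; [e] and [k] make each at most
   [d / 2]. *)
pose e := (d / 2 / (y - x))%R.
have e0 : (0 < e)%R by rewrite !divr_gt0 ?subr_gt0.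
have eE : (e * (y - x) = d / 2)%R by rewrite divfK// gt_eqF ?subr_gt0.
have va : (0 < `|v - a| + 1)%R by rewrite ltr_pwDr.
pose k := (d / 2 / (`|v - a| + 1))%R.
have k0 : (0 < k)%R by rewrite !divr_gt0.
have kE : (k * (`|v - a| + 1) = d / 2)%R by rewrite divfK// gt_eqF.
have ur : (Num.max y (r - k) < r)%R by rewrite gt_max yr/= gtrBl.
have Lce : L < (c + e)%:E by apply: le_lt_trans Lc _; rewrite lte_fin ltrDl.
have [z /andP[]] := le_left_limit wL ur Lce.
rewrite gt_max => /andP[yz rkz] zr wz.
have := @convex_on_interpolation x y z a (c + e)%R ltac:(apply: domP; lra)
  ltac:(apply: domP; lra) ltac:(lra) wxa (ltW wz).
rewrite wy lee_fin ler_pdivlMr; last lra.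
by have := ler_norm (v - a); nra.
Qed.

Lemma left_limit_gtNy r L : b = r%:E -> w z @[z --> r^'-] --> L -> -oo < L.
Proof.
move=> br wL; rewrite ltNge leeNy_eq; apply/negP => /eqP LNy.
have r0 : (0 < r)%R by rewrite -lte_fin -br.
have domP u : (0 <= u < r)%R -> dom b u by rewrite /dom /= br lee_fin lte_fin.
have [x /andP[x0 xr] wx] := le_left_limit (c := 0) wL r0 ltac:(by rewrite LNy ltNyr).
have [y /andP[xy yr] wy] := le_left_limit (c := 0) wL xr ltac:(by rewrite LNy ltNyr).
have [wy'|[v wyv]] := @dom_fin_or_pinfty y ltac:(apply: domP; lra).
  by rewrite wy' in wy.
(* A limit -oo lies below any endpoint value; the one chosen here makes the interpolated bound at
   [y] equal to [v - 1 / (r - x)]. *)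
have := @left_limit_interpolation r x y 0 ((v * (r - x) - 1) / (y - x)) L br wL
  ltac:(lra) yr (ltW wx) ltac:(by rewrite LNy leNye).
rewrite wyv lee_fin mul0r add0r divfK ?gt_eqF ?subr_gt0//.
by rewrite ler_pdivlMr ?subr_gt0 ?(lt_trans xy)//; lra.
Qed.

Let f := extend b w.

Variant extend_spec x : \bar R -> Type :=
| ExtendDom of dom b x : extend_spec x (w x)
| ExtendEnd of b = x%:E & w z @[z --> x^'-] --> f x : extend_spec x (f x)
| ExtendOut of ~~ (0 <= x%:E <= b) : extend_spec x +oo.

Lemma extendP x : extend_spec x (f x).
Proof.
rewrite /f /extend; case: ifPn => [bx|nbx]; first exact: ExtendDom.
case: eqVneq => [xb|xb].
  have -> : lim (w z @[z --> x^'-]) = f x by rewrite /f /extend (negbTE nbx) xb eqxx.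
  by apply: ExtendEnd => //; rewrite /f /extend (negbTE nbx) xb eqxx; exact: cvg_left_endpoint.
by apply: ExtendOut; move: nbx; rewrite lt_neqAle xb.
Qed.

Lemma extend_gtNy x : -oo < f x.
Proof. by case: extendP => // [/w_gtNy//|bx]; exact: left_limit_gtNy. Qed.

Lemma extend_pinfty x : ~~ (0 <= x%:E <= b) -> f x = +oo.
Proof.
case: extendP => //= [/andP[x0 xb]|bx]; first by rewrite x0 ltW.
by rewrite bx lexx andbT -bx ltW.
Qed.

Lemma extend_epi_convex : epi_convex f.
Proof.
move=> x y z a c xyz; case/andP: (xyz) => xy yz.
case: (extendP x) => [bx|bx _|/extend_pinfty]; last by rewrite leye_eq.
- case: (extendP z) => [bz|bz wz|]; last by rewrite leye_eq.
  + have -> : f y = w y.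
      rewrite /f /extend ifT//; move: bx bz => /andP[x0 _] /andP[_ zb].
      by rewrite lee_fin (le_trans _ (ltW xy)) ?(lt_trans _ zb) ?lte_fin.
    exact: convex_on_interpolation.
  + move: bx => /andP[x0 _]; rewrite lee_fin in x0.
    have -> : f y = w y.
      by rewrite /f /extend ifT// bz lee_fin lte_fin yz (le_trans x0 (ltW xy)).
    by apply: (left_limit_interpolation bz wz) => //; rewrite x0.
- have fz : f z = +oo.
    by apply: extend_pinfty; rewrite bx !lee_fin negb_and -!ltNge (lt_trans xy yz) orbT.
  by rewrite fz leye_eq.
Qed.

Lemma extend_lsc x : 0 <= x%:E <= b -> lsc_at f x.
Proof.
move=> xb a; case: (extendP x) => [bx|bx wx|]; last by rewrite xb.
- move=> /(@w_lsc x a) [V].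
  move=> /(nbhs_subspace_ex _ bx)[U xU VU] aw.
  (* Cutting the neighbourhood at [b] leaves only points of the domain, where [w_lsc] applies, and
     points where the extension is +oo. *)
  exists (U `&` [set u | u%:E < b]).
    by apply: filterI => //; apply: open_nbhs_nbhs; split;
      [exact: open_ereal_lt|case/andP: bx].
  move=> u [xu ub]; case: (extendP u) => [bu|bu wu|]; last by rewrite ltry.
    by apply: aw; have [] : (V `&` dom b) u by rewrite VU.
  by move: ub; rewrite /= bu ltxx.
- move=> af; have [u ux aw] := @cvg_at_left_interval _ _ _ _ [set y | a%:E < y]
    wx (@open_ereal_gt_ereal _ _) af.
  exists [set v | u < v]%R; first by apply: open_nbhs_nbhs; split => //; exact: open_gt.
  move=> v uv; case: (extendP v) => [/andP[_ vb]|bv wv|]; last by rewrite ltry.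
    by apply: aw; rewrite uv/= -lte_fin -bx.
  by move: bv; rewrite bx => -[<-].
Qed.

End Extension.

(** * Saturated inverse functions *)

Lemma ereal_real_between {R : realType} (x y : \bar R) :
  x < y -> exists z : R, x < z%:E < y.
Proof.
case: x y => [x| |] [y| |]//=.
- by rewrite lte_fin => xy; exists ((x + y) / 2)%R; rewrite !lte_fin; lra.
- by move=> _; exists (x + 1)%R; rewrite lte_fin ltry andbT; lra.
- by move=> _; exists (y - 1)%R; rewrite lte_fin ltNyr /=; lra.
- by move=> _; exists 0%R; rewrite ltNyr ltry.
Qed.

Section Saturated.
Local Opaque wx rderiv lderiv.
Context {R : realType}.
Variables (b beta : nat -> \bar R) (w : nat -> R -> \bar R) (e : nat).
Implicit Types (x y z c : R) (eta : \bar R).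

Local Notation f := (wx b w e).
Hypothesis f_cvx : epi_convex f.
Hypothesis f_gtNy : forall x, -oo < f x.
Hypothesis beta_b : 0 < beta e <= b e.

Local Notation H := (Hm b beta w e).
Local Notation K := (Hp b beta w e).

Let beta0 : 0 <= beta e. Proof. by case/andP: beta_b => /ltW. Qed.

Lemma lderiv_homo : forall x y, (x <= y)%R -> lderiv f x <= lderiv f y.
Proof.
move=> x y xy; have [->//|xy'] := eqVneq x y; have {}xy : (x < y)%R by rewrite lt_neqAle xy'.
exact: le_trans (lderiv_le_rderiv f_cvx f_gtNy x) (rderiv_le_lderiv f_cvx f_gtNy xy).
Qed.

Lemma rderiv_homo : forall x y, (x <= y)%R -> rderiv f x <= rderiv f y.
Proof.
move=> x y xy; have [->//|xy'] := eqVneq x y; have {}xy : (x < y)%R by rewrite lt_neqAle xy'.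
exact: le_trans (rderiv_le_lderiv f_cvx f_gtNy xy) (lderiv_le_rderiv f_cvx f_gtNy y).
Qed.

Lemma lderiv_extE : lderiv_ext f +oo = ereal_sup (range (lderiv f)).
Proof. by apply/cvg_lim => //; exact: nondecreasing_cvge lderiv_homo. Qed.

Lemma lderiv_le_ext z : z%:E <= beta e -> lderiv f z <= lderiv_ext f (beta e).
Proof.
case: (beta e) beta0 => [r _|_ _|//].
  by rewrite lee_fin => zr; exact: (lderiv_homo zr).
by rewrite lderiv_extE; apply: ereal_sup_ubound; exists z.
Qed.

Lemma lderiv_ext_fin r : lderiv_ext f r%:E = lderiv f r.
Proof. by []. Qed.

Local Opaque lderiv_ext.

Lemma rderiv_le_ext z : z%:E < beta e -> rderiv f z <= lderiv_ext f (beta e).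
Proof.
move=> /ereal_real_between[u /andP[]]; rewrite lte_fin => zu ub.
exact: le_trans (rderiv_le_lderiv f_cvx f_gtNy zu) (lderiv_le_ext (ltW ub)).
Qed.

Lemma Hm_cases eta :
  [\/ eta <= rderiv f 0%R /\ H eta = 0,
      rderiv f 0%R < eta <= lderiv_ext f (beta e) /\ H eta = im b w e eta
    | rderiv f 0%R < eta /\ lderiv_ext f (beta e) < eta /\ H eta = beta e].
Proof.
rewrite /Hm; case: leP => [h|h]; first by constructor 1.
by case: leP => h'; [constructor 2|constructor 3].
Qed.

Lemma Hp_cases eta :
  [\/ eta < rderiv f 0%R /\ K eta = 0,
      rderiv f 0%R <= eta < lderiv_ext f (beta e) /\ K eta = ip b w e eta
    | rderiv f 0%R <= eta /\ lderiv_ext f (beta e) <= eta /\ K eta = beta e].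
Proof.
rewrite /Hp; case: ltP => [h|h]; first by constructor 1.
by case: ltP => h'; [constructor 2|constructor 3].
Qed.

Local Opaque Hm Hp.

Lemma im_le z eta : 0 <= z%:E <= b e -> eta <= rderiv f z -> im b w e eta <= z%:E.
Proof. by move=> zb etaz; apply: ereal_inf_lbound; exists z. Qed.

Lemma le_ip z eta : 0 <= z%:E <= b e -> lderiv f z <= eta -> z%:E <= ip b w e eta.
Proof. by move=> zb etaz; apply: ereal_sup_ubound; exists z. Qed.

Lemma im_lt z eta : im b w e eta < z%:E -> eta <= rderiv f z.
Proof.
move=> /ereal_inf_lt[_ [u [_ etau] <-]]; rewrite lte_fin => /ltW uz.
exact: le_trans etau (rderiv_homo uz).
Qed.

Lemma lt_ip z eta : z%:E < ip b w e eta -> lderiv f z <= eta.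
Proof.
move=> /ereal_sup_gt[_ [u [_ ueta] <-]]; rewrite lte_fin => /ltW zu.
exact: le_trans (lderiv_homo zu) ueta.
Qed.

Lemma im_ge0 eta : 0 <= im b w e eta.
Proof. by apply/ereal_infP => _ [z [/andP[? _] _] <-]. Qed.

Local Opaque im ip.

(** This and the next three lemmas express that, up to strictness, H^- is the lower inverse of the
    right derivative and H^+ the upper inverse of the left derivative. They let most later arguments
    avoid the three-way definitions. *)
Lemma Hm_le z eta : 0 <= z%:E <= beta e -> eta <= rderiv f z -> H eta <= z%:E.
Proof.
move=> /andP[z0 zb] etaz; case: (Hm_cases eta) => [[_ ->//]|[_ ->]|[_ [ext ->]]].
  by apply: im_le => //; rewrite z0 (le_trans zb)//; case/andP: beta_b.
rewrite leNgt; apply/negP => /rderiv_le_ext.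
by move=> /(le_trans etaz)/(lt_le_trans ext); rewrite ltxx.
Qed.

Lemma le_Hp z eta : 0 <= z%:E <= beta e -> lderiv f z <= eta -> z%:E <= K eta.
Proof.
move=> /andP[z0 zb] etaz; case: (Hp_cases eta) => [[eta0 ->]|[_ ->]|[_ [_ ->//]]].
  rewrite lee_fin leNgt; apply/negP => /(rderiv_le_lderiv f_cvx f_gtNy).
  by move=> /(lt_le_trans eta0)/lt_le_trans/(_ etaz); rewrite ltxx.
by apply: le_ip => //; rewrite z0 (le_trans zb)//; case/andP: beta_b.
Qed.

Lemma le_rderiv_Hm z eta : 0 <= z%:E < beta e -> H eta < z%:E -> eta <= rderiv f z.
Proof.
move=> /andP[z0 zb]; case: (Hm_cases eta) => [[eta0 _] _|[_ ->]|[_ [_ ->]]].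
- by apply: (le_trans eta0); apply: rderiv_homo; rewrite -lee_fin.
- exact: im_lt.
- by move=> /(lt_trans zb); rewrite ltxx.
Qed.

Lemma lderiv_le_Hp z eta : 0 <= z%:E < beta e -> z%:E < K eta -> lderiv f z <= eta.
Proof.
move=> /andP[z0 zb]; case: (Hp_cases eta) => [[_ ->]|[_ ->]|[_ [ext _]] _].
- by rewrite ltNge z0.
- exact: lt_ip.
- exact: le_trans (lderiv_le_ext (ltW zb)) ext.
Qed.

Lemma Hm_ge0 eta : 0 <= H eta.
Proof.
by case: (Hm_cases eta) => [[_ ->//]|[_ ->]|[_ [_ ->//]]]; exact: im_ge0.
Qed.

Lemma Hp_le_beta eta : K eta <= beta e.
Proof.
case: (Hp_cases eta) => [[_ ->//]|[/andP[_ ext] ->]|[_ [_ ->//]]].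
rewrite leNgt; apply/negP; case: (beta e) beta0 ext => [r _|_ _|//]; last by rewrite ltNge leey.
by rewrite lderiv_ext_fin => ext /lt_ip; rewrite leNgt ext.
Qed.

(** A real [z] strictly between [K eta] and [H eta] would have [rderiv f z < eta < lderiv f z]. The
    bounds [K0] and [Hb] place such a [z] in [0, beta]. *)
Lemma Hm_le_Hp eta : H eta <= K eta.
Proof.
rewrite leNgt; apply/negP => /ereal_real_between[z /andP[Kz zH]].
have K0 : 0 <= K eta.
  case: (Hp_cases eta) => [[_ ->//]|[/andP[eta0 _] ->]|[_ [_ ->//]]].
  apply: le_ip; last exact: le_trans (lderiv_le_rderiv f_cvx f_gtNy 0%R) eta0.
  by rewrite lexx; case/andP: beta_b => /ltW; exact: le_trans.
have z0 : 0 <= z%:E by apply: ltW; exact: le_lt_trans Kz.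
have Hb : H eta <= beta e.
  case: (Hm_cases eta) => [[_ ->//]|[/andP[_ ext] ->]|[_ [_ ->//]]].
  case: (beta e) beta_b ext => [r /andP[r0 rb]|_ _|//]; last exact: leey.
  rewrite lderiv_ext_fin => ext.
  apply: im_le; first by rewrite (ltW r0) rb.
  exact: le_trans ext (lderiv_le_rderiv f_cvx f_gtNy r).
have zb : z%:E < beta e := lt_le_trans zH Hb.
have z0b : 0 <= z%:E <= beta e by rewrite z0 ltW.
have rz : rderiv f z < eta.
  by rewrite ltNge; apply/negP => /(Hm_le z0b); rewrite leNgt zH.
have lz : eta < lderiv f z.
  by rewrite ltNge; apply/negP => /(le_Hp z0b); rewrite leNgt Kz.
have := lt_trans rz lz; rewrite ltNge; apply/negP; rewrite negbK.
exact: lderiv_le_rderiv.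
Qed.

Lemma Hp_homo : forall eta eta', eta <= eta' -> K eta <= K eta'.
Proof.
move=> eta eta' etaeta'; rewrite leNgt; apply/negP => /ereal_real_between[z /andP[z1 z2]].
have z0 : 0 <= z%:E.
  by apply/ltW; apply: le_lt_trans z1; exact: le_trans (Hm_ge0 eta') (Hm_le_Hp eta').
have zb : z%:E < beta e := lt_le_trans z2 (Hp_le_beta eta).
have z0b : 0 <= z%:E <= beta e by rewrite z0 ltW.
have := lderiv_le_Hp (introT andP (conj z0 zb)) z2 => /le_trans/(_ etaeta').
by move=> /(le_Hp z0b); rewrite leNgt z1.
Qed.

(* Together with monotonicity: H^- is the left limit of H^+, and H^+ is
   right-continuous. *)
Lemma Hm_left_approx eta c : -oo < eta -> c%:E < H eta ->
  exists2 eta', eta' < eta & c%:E <= K eta'.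
Proof.
move=> etaNy cH; have [c0|c0] := leP 0%R c; last first.
  exists -oo => //; apply: le_trans (le_trans (Hm_ge0 -oo) (Hm_le_Hp -oo)).
  by rewrite lee_fin ltW.
have cb : 0 <= c%:E <= beta e.
  rewrite lee_fin c0 ltW// (lt_le_trans cH)//.
  exact: le_trans (Hm_le_Hp eta) (Hp_le_beta eta).
exists (rderiv f c).
  by rewrite ltNge; apply/negP => /(Hm_le cb); rewrite leNgt cH.
exact: le_Hp cb (lderiv_le_rderiv f_cvx f_gtNy c).
Qed.

Lemma Hp_right_approx eta c : eta < +oo -> K eta < c%:E ->
  exists2 eta', eta < eta' & K eta' < c%:E.
Proof.
move=> etay /ereal_real_between[z /andP[Kz zc]].
have z0 : 0 <= z%:E.
  by apply/ltW; apply: le_lt_trans Kz; exact: le_trans (Hm_ge0 eta) (Hm_le_Hp eta).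
have [bz|zb] := leP (beta e) z%:E.
  by exists +oo => //; apply: le_lt_trans zc; exact: le_trans (Hp_le_beta _) bz.
have z0b : 0 <= z%:E <= beta e by rewrite z0 ltW.
have : eta < lderiv f z.
  by rewrite ltNge; apply/negP => /(le_Hp z0b); rewrite leNgt Kz.
move=> /ereal_real_between[u /andP[etau uz]]; exists u%:E => //.
apply: le_lt_trans zc; rewrite leNgt; apply/negP => zK.
by have := lderiv_le_Hp (introT andP (conj z0 zb)) zK; rewrite leNgt uz.
Qed.

Lemma Hp_pinfty : K +oo = beta e.
Proof. by case: (Hp_cases +oo) => [[]|[/andP[_]]|[_ [_ ->]]]; rewrite // ltNge leey. Qed.

Lemma Hm_ninfty : H -oo = 0.
Proof. by case: (Hm_cases -oo) => [[_ ->]|[/andP[]]|[]]; rewrite // ltNge leNye. Qed.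

Hypothesis f_lsc : forall x, 0 <= x%:E <= b e -> lsc_at f x.

Lemma saturated_subgradient x y k : 0 <= x%:E <= beta e -> 0 <= y%:E <= beta e ->
  H k%:E <= x%:E <= K k%:E -> f x + (k * (y - x))%:E <= f y.
Proof.
move=> /andP[x0 xb] /andP[y0 yb] /andP[Hx xK].
have lx : lsc_at f x.
  by apply: f_lsc; rewrite x0 (le_trans xb)//; case/andP: beta_b.
rewrite !lee_fin in x0 y0.
have [xy|yx|->] := ltgtP x y; last by rewrite subrr mulr0 adde0.
- apply: rderiv_ge_subgradient => // z /andP[xz zy]; apply: le_rderiv_Hm.
    by rewrite lee_fin (le_trans x0 (ltW xz)) (lt_le_trans _ yb)// lte_fin.
  by apply: le_lt_trans Hx _; rewrite lte_fin.
- apply: lderiv_le_subgradient => // z /andP[yz zx]; apply: lderiv_le_Hp.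
    by rewrite lee_fin (le_trans y0 (ltW yz)) (lt_le_trans _ xb)// lte_fin.
  by apply: lt_le_trans xK; rewrite lte_fin.
Qed.

(** Substitute for the subgradient inequality at multiplier +oo. Between [x] and a larger [y] of
    finite value the right derivative would have to be +oo, but to the left of a finite value it
    never is. The next lemma is the mirror image at -oo. *)
Lemma Hm_pinfty_le x y : 0 <= x%:E -> y%:E <= beta e -> f y < +oo ->
  H +oo <= x%:E -> (y <= x)%R.
Proof.
rewrite lee_fin => x0 yb fy Hx; rewrite leNgt; apply/negP => xy.
pose z := ((x + y) / 2)%R; have [xz zy] : (x < z /\ z < y)%R by rewrite /z; lra.
have : +oo <= rderiv f z.
  apply: le_rderiv_Hm; last by apply: le_lt_trans Hx _; rewrite lte_fin.
  by rewrite lee_fin (le_trans x0 (ltW xz)) (lt_le_trans _ yb)// lte_fin.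
by rewrite leye_eq => /eqP ry; have := rderiv_lty f_cvx f_gtNy zy fy; rewrite ry.
Qed.

Lemma Hp_ninfty_ge x y : x%:E <= beta e -> 0 <= y%:E -> f y < +oo ->
  x%:E <= K -oo -> (x <= y)%R.
Proof.
rewrite lee_fin => xb y0 fy xK; rewrite leNgt; apply/negP => yx.
pose z := ((x + y) / 2)%R; have [yz zx] : (y < z /\ z < x)%R by rewrite /z; lra.
have : lderiv f z <= -oo.
  apply: lderiv_le_Hp; last by apply: lt_le_trans xK; rewrite lte_fin.
  by rewrite lee_fin (le_trans y0 (ltW yz)) (lt_le_trans _ xb)// lte_fin.
by rewrite leeNy_eq => /eqP ly; have := lderiv_gtNy f_cvx f_gtNy yz fy; rewrite ly.
Qed.

End Saturated.

(** * Levels eta_l and Gamma *)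

Section EReal.
Context {R : realType}.
Implicit Types (x y eta : \bar R) (c : R) (F G : nat -> \bar R -> \bar R).

Lemma lee_sum_nat l s (f g : nat -> \bar R) :
  (forall e, (l <= e < s)%N -> f e <= g e) ->
  \sum_(l <= e < s) f e <= \sum_(l <= e < s) g e.
Proof.
by move=> fg; rewrite big_nat_cond [leRHS]big_nat_cond; apply: lee_sum => e /andP[/fg].
Qed.

Lemma sume_nat_ge0 l s (f : nat -> \bar R) :
  (forall e, (l <= e < s)%N -> 0 <= f e) -> 0 <= \sum_(l <= e < s) f e.
Proof. by move=> f0; rewrite big_nat_cond; apply: sume_ge0 => e /andP[/f0]. Qed.

Lemma lt_adde_split c x y : -oo < x -> -oo < y -> c%:E < x + y ->
  exists c1 c2, [/\ c1%:E < x, c2%:E < y & (c <= c1 + c2)%R].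
Proof.
move=> xNy yNy cxy; have [c2 /andP[]] : exists c2 : R, c%:E - x < c2%:E < y.
  apply: ereal_real_between; move: x y xNy yNy cxy => [x| |] [y| |] //=.
  - by rewrite !lte_fin; lra.
  - by move=> _ _ _; rewrite ltry.
move=> h1 h2; exists (c - c2)%R, c2; split => //; last by rewrite subrK.
by move: x xNy {cxy} h1 => [x| |] //= _; rewrite ?ltry// !lte_fin; lra.
Qed.

Lemma adde_lt_split c x y : 0 <= x -> 0 <= y -> x + y < c%:E ->
  exists c1 c2, [/\ x < c1%:E, y < c2%:E & (c1 + c2 <= c)%R].
Proof.
case: x y => [x| |] [y| |] //= _ _; rewrite lte_fin => xy.
exists (x + (c - (x + y)) / 2)%R, (y + (c - (x + y)) / 2)%R.
by rewrite !lte_fin; split; lra.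
Qed.

(** Each summand is approximated at its own level below [eta]; by monotonicity the largest of these
    finitely many levels serves them all. It is applied with H^+ as [F] and H^- as [G]. *)
Lemma sum_left_approx (r : seq nat) F G eta c :
  {in r, forall e, {homo F e : u v / u <= v}} ->
  {in r, forall e u, 0 <= F e u} -> {in r, forall e u, 0 <= G e u} ->
  {in r, forall e d, d%:E < G e eta -> exists2 u, u < eta & d%:E <= F e u} ->
  -oo < eta -> c%:E < \sum_(e <- r) G e eta ->
  exists2 u, u < eta & c%:E <= \sum_(e <- r) F e u.
Proof.
elim: r c => [|e r IH] c homoF F0 G0 approx etaNy.
  by rewrite big_nil => c0; exists -oo => //; rewrite big_nil ltW.
have inr e' : e' \in r -> e' \in e :: r by rewrite inE orbC => ->.
have ine : e \in e :: r by rewrite inE eqxx.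
rewrite big_cons => /lt_adde_split[||c1 [c2 [/(approx _ ine)[u1 u1eta c1F]]]].
- exact: lt_le_trans (ltNyr 0) (G0 _ ine _).
- apply: (lt_le_trans (ltNyr 0)); rewrite big_seq; apply: sume_ge0 => e' /inr e'r.
  exact: G0.
move=> /IH[|||||u2 u2eta c2F cc].
- by move=> e' /inr; exact: homoF.
- by move=> e' /inr; exact: F0.
- by move=> e' /inr; exact: G0.
- by move=> e' /inr; exact: approx.
- by [].
exists (maxe u1 u2); first by rewrite gt_max u1eta.
apply: (@le_trans _ _ (c1%:E + c2%:E)); first by rewrite -EFinD lee_fin.
rewrite big_cons; apply: leeD.
  by apply: le_trans c1F _; apply: homoF; rewrite // le_max lexx.
apply: le_trans c2F _; rewrite big_seq [leRHS]big_seq; apply: lee_sum => e' /inr e'r.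
by apply: homoF; rewrite // le_max lexx orbT.
Qed.

Lemma sum_right_approx (r : seq nat) F eta c :
  {in r, forall e, {homo F e : u v / u <= v}} -> {in r, forall e u, 0 <= F e u} ->
  {in r, forall e d, F e eta < d%:E -> exists2 u, eta < u & F e u < d%:E} ->
  eta < +oo -> \sum_(e <- r) F e eta < c%:E ->
  exists2 u, eta < u & \sum_(e <- r) F e u < c%:E.
Proof.
elim: r c => [|e r IH] c homoF F0 approx etay.
  by rewrite big_nil => c0; exists +oo => //; rewrite big_nil.
have inr e' : e' \in r -> e' \in e :: r by rewrite inE orbC => ->.
have ine : e \in e :: r by rewrite inE eqxx.
rewrite big_cons => /adde_lt_split[||c1 [c2 [/(approx _ ine)[u1 u1eta c1F]]]].
- exact: F0.
- by rewrite big_seq; apply: sume_ge0 => e' /inr e'r; exact: F0.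
move=> /IH[||||u2 u2eta c2F cc].
- by move=> e' /inr; exact: homoF.
- by move=> e' /inr; exact: F0.
- by move=> e' /inr; exact: approx.
- by [].
exists (mine u1 u2); first by rewrite lt_min u1eta.
apply: (@lt_le_trans _ _ (c1%:E + c2%:E)); last by rewrite -EFinD lee_fin.
rewrite big_cons; apply: lteD.
  by apply: le_lt_trans c1F; apply: homoF; rewrite // ge_min lexx.
apply: le_lt_trans c2F; rewrite big_seq [leRHS]big_seq; apply: lee_sum => e' /inr e'r.
by apply: homoF; rewrite // ge_min lexx orbT.
Qed.

End EReal.

Record regular {R : realType} (n : nat) (b beta : nat -> \bar R)
    (w : nat -> R -> \bar R) (alpha : nat -> R) : Prop := Regular {
  regular_w_cvx : forall e, (1 <= e <= n)%N -> epi_convex (wx b w e);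
  regular_w_gtNy : forall e, (1 <= e <= n)%N -> forall x, -oo < wx b w e x;
  regular_w_lsc : forall e, (1 <= e <= n)%N -> forall x, 0 <= x%:E <= b e -> lsc_at (wx b w e) x;
  regular_beta_b : forall e, (1 <= e <= n)%N -> 0 < beta e <= b e;
  regular_alpha_ge0 : forall e, (1 <= e <= n)%N -> (0 <= alpha e)%R;
}.

Section Levels.
Context {R : realType}.
Variables (n : nat) (b beta : nat -> \bar R) (w : nat -> R -> \bar R).
Variable alpha : nat -> R.
Hypothesis reg : regular n b beta w alpha.
Local Opaque wx Hm Hp.

Local Notation H := (Hm b beta w).
Local Notation K := (Hp b beta w).
Local Notation sH := (sumHm b beta w).
Local Notation sK := (sumHp b beta w).
Local Notation sA := (sumA alpha).
Implicit Types (eta : \bar R) (l s e : nat).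

Lemma H_ge0 e eta : (1 <= e <= n)%N -> 0 <= H e eta.
Proof. by move=> en; exact: (Hm_ge0 w (regular_beta_b reg en)). Qed.

Lemma H_le_K e eta : (1 <= e <= n)%N -> H e eta <= K e eta.
Proof. by move=> en; exact: (Hm_le_Hp (regular_w_cvx reg en) (regular_w_gtNy reg en) (regular_beta_b reg en)). Qed.

Lemma K_ge0 e eta : (1 <= e <= n)%N -> 0 <= K e eta.
Proof. by move=> en; exact: le_trans (H_ge0 eta en) (H_le_K eta en). Qed.

Lemma sumHm_le_sumHp l s eta : (1 <= l)%N -> (s <= n.+1)%N -> sH l s eta <= sK l s eta.
Proof. by move=> l1 sn; apply: lee_sum_nat => e els; apply: H_le_K; lia. Qed.

Lemma sumHp_homo l s eta eta' : (1 <= l)%N -> (s <= n.+1)%N -> eta <= eta' ->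
  sK l s eta <= sK l s eta'.
Proof.
move=> l1 sn ee; apply: lee_sum_nat => e els.
by have en : (1 <= e <= n)%N by [lia]; exact: (Hp_homo (regular_w_cvx reg en) (regular_w_gtNy reg en) (regular_beta_b reg en)).
Qed.

Lemma sumA_ge0 l s : (1 <= l)%N -> (s <= n.+1)%N -> 0 <= sA l s.
Proof.
move=> l1 sn; rewrite lee_fin big_nat_cond; apply: sumr_ge0 => e; rewrite andbT => els.
by apply: (regular_alpha_ge0 reg); lia.
Qed.

Lemma sumHp_le_beta l s eta : (1 <= l)%N -> (s <= n.+1)%N ->
  sK l s eta <= \sum_(l <= e < s) beta e.
Proof.
move=> l1 sn; apply: lee_sum_nat => e els.
by have en : (1 <= e <= n)%N by [lia]; exact: (Hp_le_beta (regular_w_cvx reg en) (regular_w_gtNy reg en) (regular_beta_b reg en)).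
Qed.

(** Let v be the infimum of the levels with [sA <= sK]. Right-continuity of H^+ shows that v is
    itself such a level, and [sA < sH] at v would produce a smaller one because H^- is the left
    limit of H^+. Infinite v is settled by the values of H^+ at +oo and of H^- at -oo. The second
    conclusion makes the upper inequality alone decide about ties. *)
Lemma is_eta_exists l s : (1 <= l)%N -> (s <= n.+1)%N ->
  sA l s <= \sum_(l <= e < s) beta e ->
  exists2 eta, is_eta b beta w alpha s l eta &
    forall eta', sA l s <= sK l s eta' -> eta <= eta'.
Proof.
move=> l1 sn Ab; pose S := [set eta | sA l s <= sK l s eta].
have inr e : e \in index_iota l s -> (1 <= e <= n)%N by rewrite mem_index_iota; lia.
have Kh : {in index_iota l s, forall e, {homo K e : u v / u <= v}}.
  by move=> e /inr en; exact: (Hp_homo (regular_w_cvx reg en) (regular_w_gtNy reg en) (regular_beta_b reg en)).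
have K0 : {in index_iota l s, forall e u, 0 <= K e u}.
  by move=> e /inr en u; exact: K_ge0.
have vS eta : S eta -> ereal_inf S <= eta by exact: ereal_inf_lbound.
have AK : sA l s <= sK l s (ereal_inf S).
  have [vy|vy] := eqVneq (ereal_inf S) +oo.
    rewrite vy (_ : sK l s +oo = \sum_(l <= e < s) beta e)//.
    rewrite /sumHp big_nat_cond [RHS]big_nat_cond; apply: eq_bigr => e /andP[els _].
    exact: Hp_pinfty.
  rewrite leNgt; apply/negP => /sum_right_approx[]//.
  - move=> e /inr en d; apply: (Hp_right_approx (regular_w_cvx reg en) (regular_w_gtNy reg en) (regular_beta_b reg en)).
    by rewrite ltey.
  - by rewrite ltey.
  move=> u vu Ku; have [u' Su' u'u] := ereal_inf_lt vu.
  by have := le_lt_trans (le_trans Su' (sumHp_homo l1 sn (ltW u'u))) Ku; rewrite ltxx.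
exists (ereal_inf S) => //; split; last by move=> eta' /andP[_]; exact: vS.
rewrite /balanced AK andbT leNgt; apply/negP => AH.
have [vNy|vNy] := eqVneq (ereal_inf S) -oo.
  move: AH; rewrite vNy (_ : sH l s -oo = 0) ?ltNge ?sumA_ge0//.
  by rewrite /sumHm big1// => e _; exact: Hm_ninfty.
have [|||u uv] := sum_left_approx Kh K0 _ _ _ AH.
- by move=> e /inr en u; exact: H_ge0.
- move=> e /inr en d; apply: (Hm_left_approx (regular_w_cvx reg en) (regular_w_gtNy reg en) (regular_beta_b reg en)).
  by rewrite ltNye.
- by rewrite ltNye.
by move=> /vS; rewrite leNgt uv.
Qed.

Lemma is_Gamma_exists s : (1 < s <= n.+1)%N ->
  sA 1 s <= \sum_(1 <= e < s) beta e -> exists G, is_Gamma b beta w alpha s G.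
Proof.
move=> /andP[s1 sn] Ab.
pose S l eta := sA l s <= sK l s eta.
(* [P] holds exactly where eta_l exists, since H^+ never exceeds [beta]; index 1 satisfies it by
   hypothesis, so the minimum is over a nonempty finite set. *)
pose P (l : 'I_s) := (1 <= l)%N && (sA l s <= \sum_(l <= e < s) beta e).
pose g (l : 'I_s) := ereal_inf [set eta | S l eta].
have gP (l : 'I_s) : P l -> is_eta b beta w alpha s l (g l).
  move=> /andP[l1 /(is_eta_exists l1 sn)[eta etaP etamin]].
  have -> // : g l = eta.
  apply/eqP; rewrite eq_le; apply/andP; split; last exact/ereal_infP.
  by apply: ereal_inf_lbound; case: etaP => /andP[].
have P1 : P (Ordinal s1) by rewrite /P /= Ab.
case: (arg_minP g P1) => l Pl lmin; exists (g l); split.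
  by exists (l : nat); [case/andP: Pl => -> _; exact: ltn_ord|exact: gP].
move=> l' eta /andP[l'1 l's] l'eta.
have Pl' : P (Ordinal l's).
  rewrite /P /= l'1 /=; case: l'eta => /andP[_ AK] _.
  exact: le_trans AK (sumHp_le_beta _ l'1 sn).
apply: le_trans (lmin _ Pl') _; apply: ereal_inf_lbound.
by case: l'eta => /andP[].
Qed.

Section Stage.
Variables (s : nat) (G : \bar R).
Hypothesis sn : (1 < s <= n.+1)%N.
Hypothesis Gs : is_Gamma b beta w alpha s G.

(** The upper inequality at [G] forces eta_l <= [G], and minimality of [G] gives equality. *)
Lemma is_eta_Gamma l : (1 <= l < s)%N ->
  is_eta b beta w alpha s l G <-> sA l s <= sK l s G.
Proof.
move=> /andP[l1 ls]; case/andP: sn => _ sn'; split; first by case=> /andP[].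
move=> AK; have [eta etaP etamin] := is_eta_exists l1 sn' (le_trans AK (sumHp_le_beta _ l1 sn')).
have <- // : eta = G.
apply/eqP; rewrite eq_le etamin//=; apply: (Gs.2 l) => //.
by rewrite l1.
Qed.

(** Either [l] is tied, hence balanced at [G], or [sA > sK >= sH]. With [l = 1] this also bounds
    every single H^- below [s], which makes Psi meaningful. *)
Lemma sumHm_Gamma_le l : (1 <= l < s)%N -> sH l s G <= sA l s.
Proof.
move=> lP; have := is_eta_Gamma lP; case/andP: lP => l1 ls.
case: leP => [AK [_ /(_ isT)[/andP[]]]//|KA _].
by apply: le_trans (ltW KA); apply: sumHm_le_sumHp => //; case/andP: sn.
Qed.

End Stage.
End Levels.

Lemma lee_sum_nat_term {R : realType} l s (f : nat -> \bar R) e :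
  (forall e, (l <= e < s)%N -> 0 <= f e) -> (l <= e < s)%N ->
  f e <= \sum_(l <= e < s) f e.
Proof.
move=> f0 els; rewrite (@big_cat_nat _ _ _ e) ?(ltnW (proj2 (andP els)))//=; try lia.
rewrite (big_ltn (m := e)); last lia.
rewrite addrCA leeDl// adde_ge0// sume_nat_ge0// => i ile; apply: f0; lia.
Qed.

(** * The potentials Phi and Psi *)

Section Potentials.
Context {R : realType}.
Variables (n : nat) (b beta : nat -> \bar R) (w : nat -> R -> \bar R).
Variable alpha : nat -> R.
Hypothesis reg : regular n b beta w alpha.
Local Opaque wx Hm Hp.

Local Notation H := (Hm b beta w).
Local Notation K := (Hp b beta w).
Local Notation sH := (sumHm b beta w).
Local Notation sK := (sumHp b beta w).
Local Notation sA := (sumA alpha).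
Implicit Types (l k s e d : nat).
Variable G : \bar R.

Definition total_alpha : R := \sum_(1 <= e < n.+1) alpha e.
(* H_e^+ may be infinite.  Truncation at the sum of all alpha(e) changes none of
   the tests of the algorithm, see [sumHp_PhiE]. *)
Definition hp e : R := fine (mine (K e G) total_alpha%:E).
Definition hm e : R := fine (H e G).
Definition Phi l : R := \sum_(1 <= e < l) (hp e - alpha e).
Definition Psi l : R := \sum_(1 <= e < l) (alpha e - hm e).

Lemma sum_alpha_le_total l k : (1 <= l)%N -> (k <= n.+1)%N ->
  (\sum_(l <= e < k) alpha e <= total_alpha)%R.
Proof.
move=> l1 kn; have [lk|kl] := leqP l k; last first.
  rewrite big_geq; last exact: ltnW.
  by have := sumA_ge0 reg (leqnn 1) (leqnn n.+1); rewrite lee_fin.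
rewrite /total_alpha (@big_cat_nat _ _ _ l 1 n.+1)//=; last exact: leq_trans lk kn.
rewrite (@big_cat_nat _ _ _ k l n.+1)//=.
have := sumA_ge0 reg l1 kn; have := sumA_ge0 reg (leqnn 1) (leq_trans lk kn).
have := sumA_ge0 reg (leq_trans l1 lk) (leqnn n.+1); rewrite !lee_fin; lra.
Qed.

Lemma hpE e : (1 <= e <= n)%N -> (hp e)%:E = mine (K e G) total_alpha%:E.
Proof.
move=> en; rewrite /hp fineK//; have := K_ge0 reg G en.
have := sumA_ge0 reg (leqnn 1) (leqnn n.+1).
by case: (K e G) => [x| |] //= _ _; rewrite /mine; case: ifP.
Qed.

Lemma hp_ge0 e : (1 <= e <= n)%N -> (0 <= hp e)%R.
Proof.
move=> en; rewrite -lee_fin hpE// le_min (K_ge0 reg G en)/=.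
exact: (sumA_ge0 reg (leqnn 1) (leqnn n.+1)).
Qed.

Lemma hp_le e : (1 <= e <= n)%N -> (hp e)%:E <= K e G.
Proof. by move=> en; rewrite hpE// ge_min lexx. Qed.

Lemma PhiB l k : (1 <= l <= k)%N ->
  (Phi k - Phi l = \sum_(l <= e < k) hp e - \sum_(l <= e < k) alpha e)%R.
Proof.
by move=> /andP[l1 lk]; rewrite /Phi (@big_cat_nat _ _ _ l)//= addrAC subrr add0r sumrB.
Qed.

Lemma PsiB l k : (1 <= l <= k)%N ->
  (Psi k - Psi l = \sum_(l <= e < k) alpha e - \sum_(l <= e < k) hm e)%R.
Proof.
by move=> /andP[l1 lk]; rewrite /Psi (@big_cat_nat _ _ _ l)//= addrAC subrr add0r sumrB.
Qed.

(** If some H^+ in the block reaches the total of alpha, its truncated value alone dominates the sum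
    of alpha over the block; otherwise truncation changes nothing there. *)
Lemma sumHp_PhiE l k : (1 <= l <= k)%N -> (k <= n.+1)%N ->
  (sA l k <= sK l k G) = (Phi l <= Phi k)%R.
Proof.
move=> lk kn; rewrite -subr_ge0 PhiB// subr_ge0 -lee_fin -(sumEFin (index_iota l k) xpredT hp).
have in_n e : (l <= e < k)%N -> (1 <= e <= n)%N by lia.
apply/idP/idP => [AK|/le_trans]; last first.
  by apply; apply: lee_sum_nat => e /in_n; exact: hp_le.
have [[e elk eK]|small] := pselect (exists2 e, (l <= e < k)%N & total_alpha%:E <= K e G).
  have hpe : hp e = total_alpha by rewrite /hp (min_idPr eK).
  apply: (@le_trans _ _ (hp e)%:E).
    by rewrite hpe lee_fin sum_alpha_le_total//; case/andP: lk.
  apply: (lee_sum_nat_term (f := EFin \o hp)) => // i /in_n; rewrite lee_fin; exact: hp_ge0.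
apply: le_trans AK _; apply: lee_sum_nat => e elk; rewrite hpE ?in_n//.
rewrite le_min lexx/= leNgt; apply/negP => eK; apply: small; exists e => //; exact: ltW.
Qed.

Section Stage.
Variable s : nat.
Hypothesis sn : (1 < s <= n.+1)%N.
Hypothesis Gs : is_Gamma b beta w alpha s G.

Lemma Hm_le_total e : (1 <= e < s)%N -> H e G <= total_alpha%:E.
Proof.
move=> es; have s1 : (0 < 1 < s)%N by lia.
have := sumHm_Gamma_le reg sn Gs s1.
move=> /(le_trans _) H'; apply: le_trans (H' _ _) _; last first.
  by rewrite lee_fin sum_alpha_le_total//; lia.
by apply: lee_sum_nat_term => // i ils; apply: (H_ge0 reg); lia.
Qed.

Lemma hmE e : (1 <= e < s)%N -> (hm e)%:E = H e G.
Proof.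
move=> es; rewrite /hm fineK//; have := Hm_le_total es.
have : 0 <= H e G by apply: (H_ge0 reg); lia.
by case: (H e G).
Qed.

Lemma hm_le_hp e : (1 <= e < s)%N -> (hm e <= hp e)%R.
Proof.
move=> es; rewrite -lee_fin hmE// hpE ?le_min ?Hm_le_total ?andbT//; last lia.
by apply: (H_le_K reg); lia.
Qed.

Lemma sumHmE l k : (1 <= l)%N -> (k <= s)%N -> sH l k G = (\sum_(l <= e < k) hm e)%:E.
Proof.
move=> l1 ks; rewrite -sumEFin /sumHm big_nat_cond [RHS]big_nat_cond.
by apply: eq_bigr => e; rewrite andbT => elk; rewrite hmE//; lia.
Qed.

Lemma Psi_le l : (1 <= l < s)%N -> (Psi l <= Psi s)%R.
Proof.
move=> ls; rewrite -subr_ge0 PsiB; last lia.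
rewrite subr_ge0 -lee_fin -sumHmE//; last lia.
exact: (sumHm_Gamma_le reg sn Gs ls).
Qed.

Lemma mem_tied l :
  (l \in tied b beta w alpha s G) = (1 <= l < s)%N && (Phi l <= Phi s)%R.
Proof.
rewrite mem_filter mem_rev mem_iota; have -> : (1 <= l < 1 + s.-1)%N = (1 <= l < s)%N by lia.
rewrite andbC; case: (boolP (1 <= l < s)%N) => //= ls.
by rewrite -sumHp_PhiE; [apply/asboolP/idP => /(is_eta_Gamma reg sn Gs ls)|lia|lia].
Qed.

Lemma tied_sorted : sorted gtn (tied b beta w alpha s G).
Proof.
apply: sorted_filter; first by move=> x y z /= xy zx; exact: ltn_trans zx xy.
by rewrite rev_sorted iota_ltn_sorted.
Qed.

Lemma tied_neq0 : (0 < size (tied b beta w alpha s G))%N.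
Proof.
case: Gs => -[l ls lG] _; have : l \in tied b beta w alpha s G.
  by rewrite mem_tied ls -sumHp_PhiE; [case: lG => /andP[]|lia|lia].
by case: (tied _ _ _ _ _ _).
Qed.

(* The (lexicographic) order that the first subroutine minimizes. *)
Definition phi_preferred k l : Prop :=
  (Phi k < Phi l)%R \/ Phi k = Phi l /\ (k <= l)%N.

End Stage.
End Potentials.

Lemma exists_last_min {R : realType} (g : nat -> R) p :
  exists2 t, (1 <= t <= p.+1)%N & forall i, (1 <= i <= p.+1)%N ->
    (g t <= g i)%R /\ (g i = g t -> (i <= t)%N).
Proof.
elim: p => [|p [t tp IH]].
  by exists 1%N => // i i1; have -> : i = 1%N by lia.
have [le|lt] := leP (g p.+2) (g t).
  exists p.+2; first by lia.
  move=> i ip; split; last by lia.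
  have [->//|ip'] := eqVneq i p.+2.
  by apply: le_trans le _; apply: (IH i _).1; lia.
exists t; first by lia.
move=> i ip; have [->|ip'] := eqVneq i p.+2; last by apply: IH; lia.
by split; [exact: ltW|move=> e; rewrite e ltxx in lt].
Qed.

(** * The second subroutine *)

Section Runs.
Context {R : realType}.
Variables (n : nat) (b beta : nat -> \bar R) (w : nat -> R -> \bar R).
Variable alpha : nat -> R.
Hypothesis reg : regular n b beta w alpha.
Local Opaque wx Hm Hp.

Local Notation H := (Hm b beta w).
Local Notation K := (Hp b beta w).
Local Notation sH := (sumHm b beta w).
Local Notation sK := (sumHp b beta w).
Local Notation sA := (sumA alpha).
Local Notation Phi := (Phi n b beta w alpha).
Local Notation Psi := (Psi b beta w alpha).
Local Notation hp := (hp n b beta w alpha).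
Local Notation hm := (hm b beta w).
Local Notation tied := (tied b beta w alpha).
Local Notation preferred := (phi_preferred n b beta w alpha).
Local Notation is_Gamma := (is_Gamma b beta w alpha).
Implicit Types (l k s e d sj : nat) (x y : nat -> R) (lam : nat -> \bar R) (G : \bar R).

(** The optimality certificate restricted to the indices from [k] on: void at [k = n.+1], complete
    at [k = 1]. *)
Definition partial_solution k x lam : Prop :=
  [/\ forall e, (k <= e <= n)%N -> H e (lam e) <= (x e)%:E <= K e (lam e),
      forall l, (k <= l <= n.+1)%N ->
        (\sum_(l <= e < n.+1) x e <= \sum_(l <= e < n.+1) alpha e)%R,
      (\sum_(k <= e < n.+1) x e = \sum_(k <= e < n.+1) alpha e)%R
    & forall e, (k <= e < n)%N -> lam e.+1 <= lam e /\ (lam e.+1 < lam e ->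
        (\sum_(e.+1 <= i < n.+1) x i = \sum_(e.+1 <= i < n.+1) alpha i)%R)].

(** The multiplier may drop from [G] to [lam k] at the seam because the old certificate makes the
    tail constraint at [k] tight. *)
Lemma partial_solution_extend k k' G x x' lam : (k' <= k <= n.+1)%N ->
  partial_solution k x lam -> ((k <= n)%N -> lam k <= G) ->
  (forall e, ~~ (k' <= e < k)%N -> x' e = x e) ->
  (forall e, (k' <= e < k)%N -> H e G <= (x' e)%:E <= K e G) ->
  (forall l, (k' <= l < k)%N ->
     (\sum_(l <= e < k) x' e <= \sum_(l <= e < k) alpha e)%R) ->
  (\sum_(k' <= e < k) x' e = \sum_(k' <= e < k) alpha e)%R ->
  partial_solution k' x' (fun e => if (e < k)%N then G else lam e).
Proof.
move=> kk [xHK xle xeq lamle] lamG x'x x'HK x'le x'eq.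
have tail l : (k <= l)%N -> (\sum_(l <= e < n.+1) x' e = \sum_(l <= e < n.+1) x e)%R.
  by move=> kl; apply: eq_big_nat => e le; apply: x'x; lia.
have split (f : nat -> R) l : (l <= k)%N ->
    (\sum_(l <= e < n.+1) f e = \sum_(l <= e < k) f e + \sum_(k <= e < n.+1) f e)%R.
  by move=> lk; apply: big_cat_nat => //; lia.
split.
- move=> e en; case: ifPn => [ek|ke]; first by apply: x'HK; lia.
  by rewrite x'x; [apply: xHK; lia|lia].
- move=> l ln; have [kl|lk] := leqP k l; first by rewrite tail// xle//; lia.
  rewrite (split x' l (ltnW lk)) (split alpha l (ltnW lk)) tail// xeq lerD2r x'le//; lia.
- have k'k : (k' <= k)%N by lia.
  by rewrite (split x' k' k'k) (split alpha k' k'k) tail// xeq x'eq.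
- move=> e en; case: (ltnP e.+1 k) => [ek|ke].
    by rewrite (ltnW ek) lexx ltxx.
  rewrite tail//; case: (ltnP e k) => [ek|ke']; last by apply: lamle; lia.
  have ek' : e.+1 = k by lia.
  by rewrite ek'; split=> [|_ //]; apply: lamG; lia.
Qed.

(** [sj_preferred] is the outcome of the first subroutine; [Psi_l0] keeps gamma nonnegative, so that
    the next round can be carried out. *)
Record sub2_inv s sj G (I : seq nat) l0 (Im : seq nat) : Prop := Sub2Inv {
  s_le : (1 < s <= n.+1)%N;
  G_Gamma : is_Gamma s G;
  sj_tied : sj \in tied s G;
  sj_preferred : forall d, d \in tied s G -> preferred G sj d;
  I_def : I = [seq l <- tied s G | (sj < l)%N];
  l0_in : l0 = s \/ l0 \in I;
  Im_def : Im = [seq l <- I | (l < l0)%N && (sA l l0 <= sK l l0 G)];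
  Psi_l0 : forall l, l \in sj :: Im -> (Psi G l <= Psi G l0)%R
}.

Section Sub2.
Variables (s sj : nat) (G : \bar R) (I : seq nat) (l0 : nat) (Im : seq nat).
Hypothesis inv : sub2_inv s sj G I l0 Im.

Let sn := s_le inv.
Let Gs := G_Gamma inv.

Lemma sj_bounds : (1 <= sj < s)%N /\ (Phi G sj <= Phi G s)%R.
Proof. by have := sj_tied inv; rewrite (mem_tied reg sn Gs) => /andP[]. Qed.

Lemma l0_bounds : (sj < l0 <= s)%N /\ (Phi G l0 <= Phi G s)%R.
Proof.
case: (l0_in inv) => [->|]; first by have [] := sj_bounds; rewrite lexx; lia.
rewrite (I_def inv) mem_filter (mem_tied reg sn Gs) => /and3P[? ? ->].
by split=> //; lia.
Qed.

Lemma mem_Im l : (l \in Im) =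
  [&& (sj < l < l0)%N, l \in tied s G & (Phi G l <= Phi G l0)%R].
Proof.
have [l0b _] := l0_bounds.
rewrite {1}(Im_def inv) (I_def inv) !mem_filter.
have [sjl|] := ltnP sj l; rewrite ?andbF//=; have [ll0|] := ltnP l l0; rewrite //=.
by rewrite (sumHp_PhiE reg); [rewrite andbC|lia|lia].
Qed.

Lemma candidate_bounds l : l \in sj :: Im ->
  [/\ (sj <= l < l0)%N & (Phi G l <= Phi G l0)%R].
Proof.
have [sjb _] := sj_bounds; have [l0b _] := l0_bounds.
rewrite inE => /orP[/eqP ->|]; last by rewrite mem_Im => /and3P[? _ ->]; split=> //; lia.
split; first by lia.
case: (l0_in inv) => [->|]; first by have [] := sj_bounds.
rewrite (I_def inv) mem_filter => /andP[_ /(sj_preferred inv)[/ltW//|[-> //]]].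
Qed.

(** An untied [l] has Phi above [Phi G s], hence above [Phi G l0]; a tied one has failed the test
    that defines [Im]. Thus H^+ sums to less than alpha over [l, l0), and the tail constraint at [l]
    holds by itself. *)
Lemma Phi_gt_l0 l : (sj < l < l0)%N -> l \notin Im -> (Phi G l0 < Phi G l)%R.
Proof.
move=> ll; rewrite mem_Im ll/= negb_and -ltNge => /orP[|//].
have [l0b Pl0] := l0_bounds; have [sjb _] := sj_bounds.
rewrite (mem_tied reg sn Gs); have -> /= : (0 < l < s)%N by lia.
by rewrite -ltNge; exact: le_lt_trans.
Qed.

Local Notation lm := (lm sj l0 Im).

Lemma lm_mem i : (1 <= i <= (size Im).+1)%N -> lm i \in sj :: Im.
Proof.
case: i => // i /andP[_ ip]; rewrite -mem_rcons /Defs.lm /=.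
by apply: mem_nth; rewrite size_rcons.
Qed.

Lemma lm_index l : l \in sj :: Im ->
  exists2 i, (1 <= i <= (size Im).+1)%N & lm i = l.
Proof.
rewrite -mem_rcons => lI; exists (index l (rcons Im sj)).+1; last exact: nth_index.
by rewrite /= -(size_rcons Im sj) index_mem.
Qed.

Lemma lm_decreasing i j : (1 <= i <= j)%N -> (j <= (size Im).+1)%N -> (lm j <= lm i)%N.
Proof.
case: i j => [|i] [|j]// /andP[_ ij] jp; rewrite /Defs.lm /=.
move: ij; rewrite ltnS leq_eqVlt => /orP[/eqP ->//|ij]; apply: ltnW.
have gtn_trans : transitive gtn by move=> x y z /= xy zx; exact: ltn_trans zx xy.
have /(sorted_ltn_nth gtn_trans) : sorted gtn (rcons Im sj).
  rewrite sorted_pairwise// pairwise_rcons -sorted_pairwise//; apply/andP; split.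
    by apply/allP => l; rewrite mem_Im => /and3P[/andP[]].
  rewrite (Im_def inv) (I_def inv); do 2!apply: sorted_filter => //.
  exact: tied_sorted.
by move=> /(_ 0%N i j); rewrite !inE size_rcons => /(_ _ _ ij); apply; lia.
Qed.

Lemma slackE i : (1 <= i <= (size Im).+1)%N ->
  slack b beta w alpha sj G l0 Im i = (Psi G l0 - Psi G (lm i))%:E.
Proof.
move=> ip; have [lmb _] := candidate_bounds (lm_mem ip); have [l0b _] := l0_bounds.
have [sjb _] := sj_bounds.
rewrite /slack PsiB; last lia.
by rewrite (sumHmE reg sn Gs) -?EFinB//; lia.
Qed.

Section Round.
Variables (x x' : nat -> R) (t : nat).
Hypothesis xx' : assigned b beta w alpha sj G l0 Im x t x'.
Local Notation lt := (lm t).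
Local Notation l1 := (lm 1).

Lemma round_index : (1 <= t <= (size Im).+1)%N.
Proof. by case: xx' => gamma [[]]. Qed.

Lemma round_candidate : lt \in sj :: Im.
Proof. exact: lm_mem round_index. Qed.

(** Candidates are listed in decreasing order, so the largest index of minimal slack is the smallest
    maximizer of Psi; this gives the strict part. *)
Lemma round_Psi l : l \in sj :: Im ->
  (Psi G l <= Psi G lt)%R /\ ((l < lt)%N -> (Psi G l < Psi G lt)%R).
Proof.
move=> /lm_index[i ip <-]; case: xx' => gamma [[tp <- /(_ i ip)[]] + + _].
rewrite !slackE// lee_fin => le eqt; split; first by lra.
move=> lti; have : Psi G (lm i) <> Psi G lt; last by move/eqP; rewrite lt_neqAle => ->/=; lra.
move=> Ei; have it : (i <= t)%N by apply: eqt; rewrite Ei.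
by have := @lm_decreasing i t; lia.
Qed.

Lemma round_unchanged e : ~~ (lt <= e < l0)%N -> x' e = x e.
Proof. by case: xx' => gamma [_ [_ _ _]]; apply. Qed.

Lemma round_between e : (lt <= e < l0)%N -> H e G <= (x' e)%:E <= K e G.
Proof.
move=> el; have [l0b _] := l0_bounds; have [sjb _] := sj_bounds.
have [ltb _] := candidate_bounds round_candidate.
case: xx' => gamma [_ [x'1 _ x't _]].
have [le|gt] := leqP l1 e; first by apply: x'1; lia.
rewrite x't ?lexx /=; last lia.
by apply: (H_le_K reg); lia.
Qed.

(** All of gamma is spent above [l1], and below it [x'] equals H^-; so every sum that starts at or
    below [l1] exceeds the one of H^- by the same amount. *)
Lemma round_sum l : (lt <= l <= l1)%N ->
  (\sum_(l <= e < l0) x' e = Psi G l0 - Psi G lt + \sum_(l <= e < l0) hm G e)%R.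
Proof.
move=> ll; have [l0b _] := l0_bounds; have [sjb _] := sj_bounds.
have [ltb _] := candidate_bounds round_candidate.
have l1I : l1 \in sj :: Im by apply: lm_mem.
have [l1b _] := candidate_bounds l1I.
case: xx' => gamma [[tp <- _] [_ x'1 x't _]].
move: x'1; rewrite slackE// (sumHmE reg sn Gs); [|lia|lia].
rewrite -EFinD => -[x'1].
rewrite (@big_cat_nat _ _ _ l1 l l0)//=; [|lia|lia].
rewrite x'1 [in RHS](@big_cat_nat _ _ _ l1 l l0)//=; [|lia|lia].
rewrite (_ : \sum_(l <= e < l1) x' e = \sum_(l <= e < l1) hm G e)%R; first by ring.
apply: eq_big_nat => e el; apply: EFin_inj; rewrite x't; last lia.
by rewrite (hmE reg sn Gs)//; lia.
Qed.

Lemma round_total : (\sum_(lt <= e < l0) x' e = \sum_(lt <= e < l0) alpha e)%R.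
Proof.
have [ltb _] := candidate_bounds round_candidate; have [sjb _] := sj_bounds.
have tp := round_index.
rewrite round_sum; last by rewrite leqnn lm_decreasing//; lia.
by rewrite PsiB; [rewrite subrK|lia].
Qed.

(** At a candidate the inequality reduces to [Psi G l <= Psi G lt]; at any other index it follows
    from [Phi_gt_l0] and [x' <= H^+]. *)
Lemma round_tail l : (lt <= l < l0)%N ->
  (\sum_(l <= e < l0) x' e <= \sum_(l <= e < l0) alpha e)%R.
Proof.
move=> ll; have [ltb _] := candidate_bounds round_candidate; have [sjb _] := sj_bounds.
have [l0b _] := l0_bounds.
have [->|lsj] := eqVneq l lt; first by rewrite round_total.
have [lI|lI] := boolP (l \in Im).
  have lI' : l \in sj :: Im by rewrite inE lI orbT.
  have [Pl _] := round_Psi lI'.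
  have [i ip li] := lm_index lI'.
  rewrite round_sum; last by rewrite -{2}li lm_decreasing//; lia.
  have : (Psi G l0 - Psi G lt <= Psi G l0 - Psi G l)%R by lra.
  by rewrite (PsiB _ _ _ _ _ (l := l)); [lra|lia].
have sl : (sj < l < l0)%N by lia.
have := Phi_gt_l0 sl lI; rewrite ltNge -(sumHp_PhiE reg); [|lia|lia].
rewrite -ltNge -lee_fin -sumEFin => /ltW; apply: le_trans.
apply: lee_sum_nat => e el; have ell : (lt <= e < l0)%N by lia.
by case/andP: (round_between ell).
Qed.

Lemma round_partial_solution lam :
  partial_solution l0 x lam -> ((l0 <= n)%N -> lam l0 <= G) ->
  partial_solution lt x' (fun e => if (e < l0)%N then G else lam e).
Proof.
have [ltb _] := candidate_bounds round_candidate; have [l0b _] := l0_bounds.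
move=> /partial_solution_extend H1 /H1; apply; first by lia.
- exact: round_unchanged.
- exact: round_between.
- exact: round_tail.
- exact: round_total.
Qed.

(** The next candidates were already candidates, because [Phi G l <= Phi G lt <= Phi G l0]; so the
    maximality of Psi at [lt] covers them. *)
Lemma round_loop : lt <> sj -> sub2_inv s sj G I lt
  [seq l <- I | (l < lt)%N && (sA l lt <= sK l lt G)].
Proof.
move=> ltsj; have := round_candidate; rewrite inE => /orP[/eqP//|ltI].
have [ltb Plt] := candidate_bounds round_candidate; have [sjb _] := sj_bounds.
have [l0b _] := l0_bounds.
case: (inv) => *; split => //.
  by right; move: ltI; rewrite (Im_def inv) mem_filter => /andP[].
move=> l; rewrite inE => /orP[/eqP ->|].
  by have [_ lt_Psi] := round_Psi (mem_head sj Im); apply/ltW/lt_Psi; lia.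
rewrite mem_filter => /andP[/andP[llt Al] lI].
suff lI' : l \in sj :: Im by have [_ lt_Psi] := round_Psi lI'; apply/ltW/lt_Psi.
rewrite inE; apply/orP; right.
have [sjl lT] : (sj < l)%N /\ l \in tied s G.
  by move: lI; rewrite (I_def inv) mem_filter => /andP[].
rewrite mem_Im lT; move: Al; rewrite (sumHp_PhiE reg); [|lia|lia].
by move=> /le_trans/(_ Plt) ->; rewrite !andbT; lia.
Qed.

End Round.

Lemma round_exists x : exists t x', assigned b beta w alpha sj G l0 Im x t x'.
Proof.
have [l0b _] := l0_bounds; have [sjb _] := sj_bounds.
have [t tp tmin] := exists_last_min (fun i => Psi G l0 - Psi G (lm i))%R (size Im).
have l1I : lm 1 \in sj :: Im by apply: lm_mem.
have [l1b Pl1] := candidate_bounds l1I.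
pose gamma := (Psi G l0 - Psi G (lm t))%R.
have g0 : (0 <= gamma)%R.
  by rewrite subr_ge0; apply: (Psi_l0 inv); exact: lm_mem.
pose D := (\sum_(lm 1 <= e < l0) (hp G e - hm G e))%R.
(* gamma is at most the slack at [lm 1], which is the sum of alpha minus that of H^-, and
   [Phi (lm 1) <= Phi l0] bounds the sum of alpha by that of the truncated H^+. *)
have gD : (gamma <= D)%R.
  have [g1 _] := tmin 1%N isT; apply: (le_trans g1); rewrite PsiB; last lia.
  move: Pl1; rewrite -subr_ge0 PhiB; last lia.
  by rewrite /D sumrB; lra.
(* The same convex combination of H^- and truncated H^+ at every index. If [D = 0] then gamma is 0
   too, and the convention [gamma / 0 = 0] gives a correct weight. *)
pose th := (gamma / D)%R.
have thD : (th * D = gamma)%R.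
  have [D0|D0] := eqVneq D 0%R; last by rewrite /th divfK.
  by rewrite D0 mulr0; apply/eqP; rewrite eq_le g0 -D0 gD.
have th01 : (0 <= th <= 1)%R.
  have D0 : (0 <= D)%R := le_trans g0 gD.
  rewrite /th divr_ge0//=; have [->|Dn0] := eqVneq D 0%R; first by rewrite invr0 mulr0.
  by rewrite ler_pdivrMr ?mul1r// lt_neqAle eq_sym Dn0.
exists t, (fun e => if (lm 1 <= e < l0)%N then hm G e + th * (hp G e - hm G e)
  else if (lm t <= e < lm 1)%N then hm G e else x e)%R.
exists gamma%:E; split; split => //.
- by rewrite slackE.
- move=> i ip; have [gi it] := tmin i ip; rewrite slackE// lee_fin; split => //.
  by move=> -[/it].
- move=> e el; rewrite el -(hmE reg sn Gs); last lia.
  have hmp : (hm G e <= hp G e)%R by apply: (hm_le_hp reg sn Gs); lia.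
  have hpK : (hp G e)%:E <= K e G by apply: hp_le; [exact: reg|lia].
  by rewrite lee_fin (le_trans _ hpK) ?andbT ?lee_fin; nra.
- rewrite (sumHmE reg sn Gs); [|lia|lia].
  rewrite -EFinD; congr EFin.
  rewrite -thD /D mulr_sumr -big_split/=; apply: eq_big_nat => e el.
  by rewrite el addrC.
- move=> e el; have -> : (lm 1 <= e < l0)%N = false by lia.
  by rewrite el (hmE reg sn Gs)//; have [] := candidate_bounds (lm_mem tp); lia.
- move=> e el; have [ltb _] := candidate_bounds (lm_mem tp).
  have lt1 : (lm t <= lm 1)%N by [apply: lm_decreasing; lia].
  have -> : (lm 1 <= e < l0)%N = false by lia.
  by have -> : (lm t <= e < lm 1)%N = false by lia.
Qed.

End Sub2.
End Runs.

(** * Invariants and termination *)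

Section Termination.
Context {R : realType}.
Variables (n : nat) (b beta : nat -> \bar R) (w : nat -> R -> \bar R).
Variable alpha : nat -> R.
Hypothesis reg : regular n b beta w alpha.
Hypothesis alpha_le_beta : forall s, (s <= n.+1)%N ->
  sumA alpha 1 s <= \sum_(1 <= e < s) beta e.
Local Opaque wx Hm Hp.

Local Notation sK := (sumHp b beta w).
Local Notation sA := (sumA alpha).
Local Notation Phi := (Phi n b beta w alpha).
Local Notation tied := (tied b beta w alpha).
Local Notation tie := (tie b beta w alpha).
Local Notation preferred := (phi_preferred n b beta w alpha).
Local Notation is_Gamma := (is_Gamma b beta w alpha).
Local Notation balanced := (balanced b beta w alpha).
Local Notation partial_solution := (partial_solution n b beta w alpha).
Local Notation sub2_inv := (sub2_inv n b beta w alpha).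
Local Notation step := (step b beta w alpha).
Implicit Types (l k s e d i t sj : nat) (x y : nat -> R) (lam : nat -> \bar R) (G : \bar R).

Lemma preferred_trans G : forall i j k, preferred G i j -> preferred G j k -> preferred G i k.
Proof.
move=> i j k [ij|[ij ij']] [jk|[jk jk']].
- by left; exact: lt_trans jk.
- by left; rewrite -jk.
- by left; rewrite ij.
- by right; rewrite ij; split=> //; exact: leq_trans jk'.
Qed.

Lemma tie_mem s G i : (1 <= i <= size (tied s G))%N -> tie s G i \in tied s G.
Proof. by case: i => // i /andP[_ ip]; exact: mem_nth. Qed.

Lemma tie_decreasing s G i t : (1 <= i < t)%N -> (t <= size (tied s G))%N ->
  (tie s G t < tie s G i)%N.
Proof.
case: i t => [|i] [|t]// /andP[_ it] ts.
have gtn_trans : transitive gtn by move=> u v z /= uv zu; exact: ltn_trans zu uv.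
have /(sorted_ltn_nth gtn_trans) := tied_sorted b beta w alpha G s.
by move=> /(_ 0%N i t); rewrite !inE; apply=> //; lia.
Qed.

(** The last clause carries the monotonicity of the multipliers to the next iteration, whose Gamma
    is a balanced level for some [l < s]. *)
Definition outer_inv s x : Prop :=
  (1 < s <= n.+1)%N /\ exists2 lam, partial_solution s x lam &
    (s <= n)%N -> forall l eta, (1 <= l < s)%N -> balanced s l eta -> lam s <= eta.

(** In [Sub1] the window from [i] to [t] always retains a tie at least as preferred as any given
    one, so the survivor at [i = t] is the minimum. *)
Definition run_inv (c : @state R) : Prop :=
  match c with
  | Outer s x => outer_inv s x
  | Sub1 s G i t x =>
      [/\ outer_inv s x, is_Gamma s G, (1 <= i <= t)%N, (t <= size (tied s G))%N
        & forall d, d \in tied s G ->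
            exists2 j, (i <= j <= t)%N & preferred G (tie s G j) d]
  | Sub2 sj G T l0 Im x =>
      exists s lam, [/\ sub2_inv s sj G T l0 Im, partial_solution l0 x lam
                      & (l0 <= n)%N -> lam l0 <= G]
  | Exit x => exists lam, partial_solution 1 x lam
  end.

(** Each outer iteration has a budget of [2 * n + 4]: fewer than [n] moves of the window, and then
    [l0], which starts at [s <= n.+1] and decreases. The offset [n + 3] exceeds this starting value,
    so entering [Sub2] is a descent as well. *)
Definition run_measure (c : @state R) : nat :=
  match c with
  | Outer s _ => s * (2 * n + 4)
  | Sub1 s _ i t _ => s.-1 * (2 * n + 4) + (n + 3) + (t - i)
  | Sub2 sj _ _ l0 _ _ => sj * (2 * n + 4) + l0
  | Exit _ => 0
  end.

(** Since equal Phi is resolved towards the smallest index, every [l < sj] has strictly larger Phi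
    than [sj]. A balanced level below [G] would, by monotonicity of H^+, give the opposite
    inequality. *)
Lemma sub2_next_level s sj G T l0 Im l eta : sub2_inv s sj G T l0 Im ->
  (1 <= l < sj)%N -> balanced sj l eta -> G <= eta.
Proof.
move=> inv lsj /andP[_ AK]; rewrite leNgt; apply/negP => etaG.
have [sjb Psj] := sj_bounds reg inv; have sn := s_le inv.
have : (Phi G sj < Phi G l)%R.
  have := sj_preferred inv (d := l).
  rewrite (mem_tied reg sn (G_Gamma inv)); have -> /= : (0 < l < s)%N by lia.
  by case: (leP (Phi G l) (Phi G s)) => [_ /(_ isT)[//|[_]]|Pl _]; [lia|exact: le_lt_trans Pl].
rewrite ltNge -(sumHp_PhiE reg); [|lia|lia].
by rewrite (le_trans AK)// (sumHp_homo reg _ _ (ltW etaG))//; lia.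
Qed.

Lemma tied_size_le s G : (size (tied s G) <= s.-1)%N.
Proof. by rewrite size_filter (leq_trans (count_size _ _))// size_rev size_iota. Qed.

Lemma step_inv c c' : run_inv c -> step c c' ->
  run_inv c' /\ (run_measure c' < run_measure c)%N.
Proof.
move=> + st; case: st => /=.
- move=> s G x Gs sx; have sn := sx.1.
  have t0 := tied_neq0 reg sn Gs; have ts := tied_size_le s G.
  split; last by case: s {sx Gs} t0 sn ts => // s; rewrite mulSn /=; lia.
  split=> //.
  move=> d dT; exists (index d (tied s G)).+1.
    by rewrite /= index_mem.
  by right; rewrite /tie /= nth_index.
- move=> s G i t x it Ak [sx Gs /andP[i1 it'] tT dom].
  have {}it : (i < t)%N by lia.
  have sn := sx.1.
  split; last by lia.
  split=> //.
  move=> d /dom[j jit jd]; have [ji|ji] := eqVneq j i; last by exists j => //; lia.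
  (* The passed test says that Phi at l_t is at most Phi at l_i; as l_t is also the smaller index,
     it is preferred even when they are equal. *)
  exists t; first by lia.
  apply: preferred_trans jd; rewrite ji.
  have tP : (1 <= t <= size (tied s G))%N by lia.
  have iP : (1 <= i <= size (tied s G))%N by lia.
  have := tie_mem iP; rewrite (mem_tied reg sx.1 Gs) => /andP[ib _].
  have := tie_mem tP; rewrite (mem_tied reg sx.1 Gs) => /andP[tb _].
  have tdi : (tie s G t < tie s G i)%N by [apply: tie_decreasing; lia].
  move: Ak; rewrite (sumHp_PhiE reg); [|lia|lia].
  by rewrite le_eqVlt => /orP[/eqP ?|?]; [right; split=> //; lia|left].
- move=> s G i t x it Ak [sx Gs /andP[i1 it'] tT dom].
  have {}it : (i < t)%N by lia.
  have sn := sx.1.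
  split; last by lia.
  split=> //; try lia.
  move=> d /dom[j jit jd]; have [jt|jt] := eqVneq j t; last by exists j => //; lia.
  exists i; first by lia.
  apply: preferred_trans jd; rewrite jt.
  have tP : (1 <= t <= size (tied s G))%N by lia.
  have iP : (1 <= i <= size (tied s G))%N by lia.
  have := tie_mem iP; rewrite (mem_tied reg sx.1 Gs) => /andP[ib _].
  have := tie_mem tP; rewrite (mem_tied reg sx.1 Gs) => /andP[tb _].
  have tdi : (tie s G t < tie s G i)%N by [apply: tie_decreasing; lia].
  move/negP: Ak; rewrite (sumHp_PhiE reg); [|lia|lia].
  by rewrite -ltNge; left.
- move=> s G i x [[sn [lam xlam lams]] Gs i1 iT dom].
  have iP : (1 <= i <= size (tied s G))%N by lia.
  have := tie_mem iP; rewrite (mem_tied reg sn Gs) => /andP[ib Pi].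
  split; last first.
    rewrite subnn; have : (tie s G i * (2 * n + 4) <= s.-1 * (2 * n + 4))%N.
      by rewrite leq_mul2r; lia.
    lia.
  exists s, lam; split => //; last first.
    move=> /lams lamG; have [[l ls [lG _]] _] := Gs; exact: lamG lG.
  split=> //.
  + exact: tie_mem.
  + by move=> d /dom[j ij]; have -> : j = i by lia.
  + by left.
  (* In the first round l0 is [s], and the test that filters later candidate sets is the tie
     condition itself, so it removes nothing. *)
  + symmetry; apply/all_filterP/allP => l; rewrite mem_filter (mem_tied reg sn Gs).
    move=> /and3P[_ lb Pl]; rewrite (sumHp_PhiE reg) ?Pl ?andbT; lia.
  + move=> l; rewrite inE => lI; apply: (Psi_le reg sn Gs); move: lI => /orP[/eqP ->//|].
    by rewrite mem_filter (mem_tied reg sn Gs) => /and3P[].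
- move=> sj G T l0 Im x t x' xx' ltsj [s [lam [inv xlam lamG]]].
  have ltI := round_candidate xx'.
  have [ltb _] := candidate_bounds reg inv ltI.
  split; last by lia.
  exists s, (fun e => if (e < l0)%N then G else lam e); split.
  + exact: (round_loop reg inv xx').
  + exact: (round_partial_solution reg inv xx').
  + by have -> : (lm sj l0 Im t < l0)%N by lia.
- move=> sj G T l0 Im x t x' xx' ltsj sj1 [s [lam [inv xlam lamG]]].
  have [l0b _] := l0_bounds reg inv; have [sjb _] := sj_bounds reg inv.
  have sn := s_le inv.
  split; last by lia.
  split; first by lia.
  exists (fun e => if (e < l0)%N then G else lam e).
    by rewrite -ltsj; exact: (round_partial_solution reg inv xx').
  move=> _ l eta ll leta; have -> : (sj < l0)%N by lia.
  exact: (sub2_next_level inv ll leta).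
- move=> sj G T l0 Im x t x' xx' ltsj sj1 [s [lam [inv xlam lamG]]].
  have [l0b _] := l0_bounds reg inv; split; last by lia.
  exists (fun e => if (e < l0)%N then G else lam e).
  by rewrite -sj1 -ltsj; exact: (round_partial_solution reg inv xx').
Qed.

Lemma step_exists c : run_inv c -> (exists x, c = Exit x) \/ exists c', step c c'.
Proof.
case: c => [s x|s G i t x|sj G T l0 Im x|x] /=; last by left; exists x.
- move=> [sn _]; have [|G Gs] := is_Gamma_exists reg sn.
    by apply: alpha_le_beta; case/andP: sn.
  by right; eexists; exact: (step_tied x Gs).
- move=> _; right; have [->|it] := eqVneq i t; first by eexists; exact: step_sub1_return.
  have it' : i <> t by apply/eqP.
  have [Ak|Ak] := pselect (is_true (sA (tie s G t) (tie s G i) <= sK (tie s G t) (tie s G i) G)).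
    by eexists; exact: step_sub1_i.
  by eexists; exact: step_sub1_t.
- move=> [s [lam [inv _ _]]]; right; have [t [x' xx']] := round_exists reg inv x.
  have [ltsj|ltsj] := eqVneq (lm sj l0 Im t) sj; last first.
    by eexists; apply: (step_sub2_loop T xx'); exact/eqP.
  have [sj1|sj1] := eqVneq sj 1%N; first by eexists; exact: (step_sub2_exit T xx').
  by eexists; apply: (step_sub2_next T xx') => //; exact/eqP.
Qed.

Lemma reachable_inv c c' : reachable b beta w alpha c c' -> run_inv c -> run_inv c'.
Proof.
elim=> [u v uv|u|u v z _ uv _ vz] //; first by move=> /step_inv/(_ uv)[].
by move=> /uv/vz.
Qed.

Lemma run_inv_completes c : run_inv c -> runs_to_completion b beta w alpha c.
Proof.
move=> cinv; split; last by move=> c' /reachable_inv/(_ cinv)/step_exists.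
have [m cm] : exists m, (run_measure c < m)%N by exists (run_measure c).+1.
elim: m c cinv cm => [//|m IH] c cinv cm; constructor => c' cc'.
by have [c'inv lt] := step_inv cinv cc'; apply: IH c'inv _; exact: leq_trans lt cm.
Qed.

Lemma start_inv x0 : (0 < n)%N -> run_inv (start n x0).
Proof.
move=> n0; split; first by lia.
exists (fun=> 0); last by lia.
split=> [e|l|//|e]; try lia.
  by move=> ln; have -> : l = n.+1 by [lia]; rewrite !big_geq.
by rewrite !big_geq.
Qed.

End Termination.

(** * Optimality *)

(** Summation by parts from the right end: passing from [mu m.+1] to [mu m] on the tail beyond [m]
    changes nothing or multiplies a nonpositive tail sum by a larger factor. In the application [d]
    sums to 0, so the left side vanishes. *)
Lemma abel_summation_ge {R : realDomainType} (n : nat) (d mu : nat -> R) :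
  (forall e, (1 <= e < n)%N -> (mu e.+1 <= mu e)%R /\
     ((mu e.+1 < mu e)%R -> (\sum_(e.+1 <= i < n.+1) d i <= 0)%R)) ->
  (0 < n)%N ->
  (mu 1%N * \sum_(1 <= e < n.+1) d e <= \sum_(1 <= e < n.+1) mu e * d e)%R.
Proof.
move=> mud n0; suff H k : (k < n)%N ->
    (mu (n - k)%N * \sum_((n - k)%N <= e < n.+1) d e
      <= \sum_((n - k)%N <= e < n.+1) mu e * d e)%R.
  by have := H n.-1 ltac:(lia); have -> : (n - n.-1 = 1)%N by lia.
elim: k => [_|k IH kn]; first by rewrite subn0 !big_nat1.
have {}IH := IH (ltnW kn); have nk : ((n - k) = (n - k.+1).+1)%N by lia.
have [mule mult] := mud (n - k.+1)%N ltac:(lia).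
rewrite (big_ltn (m := (n - k.+1)%N)); last lia.
rewrite [leRHS](big_ltn (m := (n - k.+1)%N)); last lia.
rewrite nk in IH; set m := (n - k.+1)%N in IH mule mult *.
set D := (\sum_(m.+1 <= i < n.+1) d i)%R in IH mult *.
rewrite mulrDr lerD2l; apply: le_trans IH.
move: mule; rewrite le_eqVlt => /orP[/eqP ->//|lt].
by rewrite ler_wnM2r ?mult// ltW.
Qed.

Lemma sume_gtNy {R : realDomainType} (r : seq nat) (f : nat -> \bar R) :
  {in r, forall e, -oo < f e} -> -oo < \sum_(e <- r) f e.
Proof.
move=> fNy; rewrite big_seq; elim/big_ind: _ => [//|x y|e /fNy//].
by case: x y => [x| |] [y| |] //= _ _; rewrite ltNyr.
Qed.

Lemma sume_pinfty {R : realDomainType} (r : seq nat) (f : nat -> \bar R) e :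
  {in r, forall e, -oo < f e} -> e \in r -> f e = +oo -> \sum_(e <- r) f e = +oo.
Proof.
elim: r => // i r IH fNy; rewrite inE big_cons => /orP[/eqP <- ->|er fe].
  rewrite addye// -ltNye; apply: sume_gtNy => j jr; apply: fNy.
  by rewrite inE jr orbT.
rewrite IH//; last by move=> j jr; apply: fNy; rewrite inE jr orbT.
by rewrite addey// -ltNye fNy// mem_head.
Qed.

Section Optimality.
Context {R : realType}.
Variables (n : nat) (b beta : nat -> \bar R) (w : nat -> R -> \bar R).
Variable alpha : nat -> R.
Hypothesis n_gt0 : (0 < n)%N.
Hypothesis reg : regular n b beta w alpha.
Local Opaque wx Hm Hp.

Lemma feasible_tail_le y l : feasible n beta alpha y -> (1 <= l <= n.+1)%N ->
  (\sum_(l <= e < n.+1) y e <= \sum_(l <= e < n.+1) alpha e)%R.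
Proof.
move=> [_ yle yeq] ln.
have [->|l1] := eqVneq l 1%N; first by rewrite yeq.
have [->|ln1] := eqVneq l n.+1; first by rewrite !big_geq.
have := yle l.-1 ltac:(lia); have -> : l.-1.+1 = l by lia.
have := yeq; rewrite (@big_cat_nat _ _ _ l 1 n.+1)//=; [|lia|lia].
rewrite [in X in _ = X -> _](@big_cat_nat _ _ _ l 1 n.+1)//=; [|lia|lia].
lra.
Qed.

Lemma feasible_total_le y s : feasible n beta alpha y -> (s <= n.+1)%N ->
  sumA alpha 1 s <= \sum_(1 <= e < s) beta e.
Proof.
move=> yf sn; apply: (@le_trans _ _ (\sum_(1 <= e < s) y e)%:E); last first.
  rewrite -sumEFin; apply: lee_sum_nat => e es.
  by case: yf => /(_ e) yb _ _; have /andP[] := yb ltac:(lia).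
have [s0|s0] := leqP s 1; first by rewrite /sumA !big_geq.
have := feasible_tail_le yf (l := s) ltac:(lia).
case: yf => _ _; rewrite lee_fin (@big_cat_nat _ _ _ s 1 n.+1)//=; [|lia].
rewrite [in X in _ = X -> _](@big_cat_nat _ _ _ s 1 n.+1)//=; [|lia].
lra.
Qed.

Variables (x : nat -> R) (lam : nat -> \bar R).
Hypothesis xlam : partial_solution n b beta w alpha 1 x lam.

Let xHK e : (1 <= e <= n)%N -> Hm b beta w e (lam e) <= (x e)%:E <= Hp b beta w e (lam e).
Proof. by case: xlam => + _ _ _; exact. Qed.

Let x_bounds e : (1 <= e <= n)%N -> 0 <= (x e)%:E <= beta e.
Proof.
move=> en; have /andP[Hx xK] := xHK en.
rewrite (le_trans (H_ge0 reg (lam e) en) Hx)/= (le_trans xK)//.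
exact: (Hp_le_beta (regular_w_cvx reg en) (regular_w_gtNy reg en) (regular_beta_b reg en)).
Qed.

Lemma partial_solution_feasible : feasible n beta alpha x.
Proof.
case: xlam => _ xle xeq _; split=> // l ln.
have := xle l.+1 ltac:(lia); move: xeq.
rewrite (@big_cat_nat _ _ _ l.+1 1 n.+1)//=; [|lia].
rewrite [in X in _ = X -> _](@big_cat_nat _ _ _ l.+1 1 n.+1)//=; [|lia].
lra.
Qed.

Section Competitor.
Variable y : nat -> R.
Hypothesis y_feasible : feasible n beta alpha y.

(** Where [g \o lam] drops, [lam] drops, so the tail of [x] is tight there and the tail of [y - x]
    is at most 0. *)
Lemma multiplier_sum_ge0 (g : \bar R -> R) :
  (forall e, (1 <= e < n)%N -> (g (lam e.+1) <= g (lam e))%R) ->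
  (0 <= \sum_(1 <= e < n.+1) g (lam e) * (y e - x e))%R.
Proof.
move=> gle; have [_ _ xeq lamle] := xlam; have [_ _ yeq] := y_feasible.
have := @abel_summation_ge _ n (fun e => y e - x e)%R (g \o lam) _ n_gt0.
rewrite sumrB xeq yeq subrr mulr0; apply=> e en; split; first exact: gle.
have [le lt] := lamle e ltac:(lia).
move=> /= glt; rewrite sumrB lt; last first.
  by rewrite lt_neqAle le andbT; apply: contraTneq glt => ->; rewrite ltxx.
by rewrite subr_le0 feasible_tail_le//; lia.
Qed.

Hypothesis y_fin : forall e, (1 <= e <= n)%N -> wx b w e (y e) < +oo.

(* Any nondecreasing function of the multipliers can be used in the Abel
   summation; this one isolates the blocks with an infinite multiplier, where
   all terms are nonpositive and hence vanish. *)
Let infinity_sign (u : \bar R) : R :=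
  match u with _%:E => 0%R | +oo => 1%R | -oo => (-1)%R end.

Lemma infinite_multiplier_eq e : (1 <= e <= n)%N -> lam e \isn't a fin_num ->
  y e = x e.
Proof.
move=> en lame; have [_ _ _ lamle] := xlam; have [yb _ _] := y_feasible.
have sgle i : (1 <= i < n)%N -> (infinity_sign (lam i.+1) <= infinity_sign (lam i))%R.
  move=> iN; have [+ _] := lamle i ltac:(lia).
  by case: (lam i) (lam i.+1) => [u| |] [v| |]//=; rewrite ?lexx; lra.
have term i : (1 <= i < n.+1)%N -> (infinity_sign (lam i) * (y i - x i) <= 0)%R.
  move=> iN; have iN' : (1 <= i <= n)%N by lia.
  have /andP[x0 xb] := x_bounds iN'; have /andP[y0 yb'] := yb i iN'.
  have := xHK iN'; case: (lam i) => [u| |] /=; first by rewrite mul0r.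
    move=> /andP[+ _]; have := y_fin iN' => yi.
    move=> /(Hm_pinfty_le (regular_w_cvx reg iN') (regular_w_gtNy reg iN') x0 yb' yi).
    by rewrite mul1r subr_le0.
  move=> /andP[_]; have := y_fin iN' => yi.
  move=> /(Hp_ninfty_ge (regular_w_cvx reg iN') (regular_w_gtNy reg iN') (regular_beta_b reg iN') xb y0 yi).
  by rewrite mulN1r oppr_le0 subr_ge0.
have := multiplier_sum_ge0 sgle; rewrite (@big_cat_nat _ _ _ e 1 n.+1)//=; [|lia|lia].
rewrite (big_ltn (m := e)); last lia.
have A1 : (\sum_(1 <= i < e) infinity_sign (lam i) * (y i - x i) <= 0)%R.
  by rewrite big_nat_cond; apply: sumr_le0 => i; rewrite andbT => ie; apply: term; lia.
have A2 : (\sum_(e.+1 <= i < n.+1) infinity_sign (lam i) * (y i - x i) <= 0)%R.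
  by rewrite big_nat_cond; apply: sumr_le0 => i; rewrite andbT => ie; apply: term; lia.
have : (infinity_sign (lam e) * (y e - x e) <= 0)%R by apply: term; lia.
by case: (lam e) lame => //= _; lra.
Qed.

Let bound : R := (\sum_(1 <= e < n.+1) `|fine (lam e)|)%R.

(** [bound] dominates all finite multipliers in absolute value, so clamping preserves their order;
    the values assigned to infinite multipliers meet only terms with [y e = x e]. *)
Let clamp (u : \bar R) : R :=
  match u with r%:E => r | +oo => bound | -oo => (- bound)%R end.

Lemma finite_values_optimal : W n b w x <= W n b w y.
Proof.
have [_ _ _ lamle] := xlam; have [yb _ _] := y_feasible.
have bound_ge e : (1 <= e <= n)%N -> (`|fine (lam e)| <= bound)%R.
  move=> en; rewrite -lee_fin -sumEFin.
  by apply: (lee_sum_nat_term (f := fun e => `|fine (lam e)|%:E)); [move=> *; rewrite lee_fin|lia].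
have bound0 : (0 <= bound)%R by rewrite /bound sumr_ge0.
have clample e : (1 <= e < n)%N -> (clamp (lam e.+1) <= clamp (lam e))%R.
  move=> en; have [+ _] := lamle e ltac:(lia).
  have := bound_ge e ltac:(lia); have := bound_ge e.+1 ltac:(lia).
  case: (lam e) (lam e.+1) => [u| |] [v| |]//=; rewrite ?lexx// ?ler_norml; try lra.
have sum0 := multiplier_sum_ge0 clample.
apply: (@le_trans _ _ (W n b w x + (\sum_(1 <= e < n.+1) clamp (lam e) * (y e - x e))%R%:E)).
  by rewrite leeDl// lee_fin.
rewrite /W -sumEFin -big_split/=; apply: lee_sum_nat => e en.
have en' : (1 <= e <= n)%N by lia.
have [lame|lame] := boolP (lam e \is a fin_num); last first.
  by rewrite (infinite_multiplier_eq en' lame) subrr mulr0 adde0.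
have := xHK en'; rewrite -(fineK lame) /= => xHKe.
apply: (saturated_subgradient (regular_w_cvx reg en') (regular_w_gtNy reg en') (regular_beta_b reg en')
  (regular_w_lsc reg en') (x_bounds en') (yb e en') xHKe).
Qed.

End Competitor.

Lemma partial_solution_optimal y : feasible n beta alpha y -> W n b w x <= W n b w y.
Proof.
move=> yf; have [fin|] := pselect (forall e, (1 <= e <= n)%N -> wx b w e (y e) < +oo).
  exact: finite_values_optimal.
move=> /existsNP[e /not_implyP[en /negP]]; rewrite -leNgt leye_eq => /eqP yoo.
have -> : W n b w y = +oo.
  apply: (sume_pinfty (e := e)) => //; last by rewrite mem_index_iota; lia.
  move=> i; rewrite mem_index_iota => iN.
  by apply: (regular_w_gtNy reg); lia.
exact: leey.
Qed.

End Optimality.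

Theorem theorem3 (R : realType) (n : nat) (b beta : nat -> \bar R)
    (w : nat -> R -> \bar R) (alpha : nat -> R)
    (n_gt0 : (0 < n)%N)
    (b_gt0 : forall e, (1 <= e <= n)%N -> 0 < b e)
    (w_convex : forall e, (1 <= e <= n)%N -> convex_on (b e) (w e))
    (w_gtNy : forall e x, (1 <= e <= n)%N -> dom (b e) x -> -oo < w e x)
    (w_lsc : forall e, (1 <= e <= n)%N ->
       @lower_semicontinuous (subspace (dom (b e))) R (w e))
    (beta_gt0 : forall e, (1 <= e <= n)%N -> 0 < beta e <= b e)
    (alpha_ge0 : forall e, (1 <= e <= n)%N -> (0 <= alpha e)%R)
    (feas : exists y : nat -> R, feasible n beta alpha y)
    (x0 : nat -> R) :
  runs_to_completion b beta w alpha (start n x0) /\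
  forall x : nat -> R,
    reachable b beta w alpha (start n x0) (Exit x) ->
    feasible n beta alpha x /\
    forall y : nat -> R, feasible n beta alpha y -> W n b w x <= W n b w y.
Proof.
have reg : regular n b beta w alpha.
  split=> // e en.
  - exact: (extend_epi_convex (b_gt0 e en) (w_convex e en) (fun x => @w_gtNy e x en)).
  - exact: (extend_gtNy (b_gt0 e en) (w_convex e en) (fun x => @w_gtNy e x en)).
  - exact: (extend_lsc (b_gt0 e en) (w_convex e en) (fun x => @w_gtNy e x en) (w_lsc e en)).
have [y yf] := feas.
(* Nonemptiness of the feasible set enters through these inequalities, which make eta_1 exist in
   every iteration. *)
have alpha_le_beta s (sn : (s <= n.+1)%N) := feasible_total_le n_gt0 yf sn.
have start_ok := start_inv b beta w alpha x0 n_gt0.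
split; first exact: (run_inv_completes reg alpha_le_beta start_ok).
move=> x /(reachable_inv reg)/(_ start_ok)[lam xlam]; split.
  exact: (partial_solution_feasible n_gt0 reg xlam).
by move=> z zf; exact: (partial_solution_optimal n_gt0 reg xlam zf).
Qed.
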